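(* Let $\mathscr M\subset ba(\mathcal A)$ be norm bounded. Then conditions (i)–(v) below are mutually equivalent and imply (vi). If $\mathcal A$ is a $\sigma$-algebra and $\mathscr M\subset ca(\mathcal A)$, then (vi) implies (iii) (so all six are equivalent). (i) $\lim_{m(A)\to0}\sup_{\mu\in\mathscr M}|\mu|(A)=0$ for some $m\in\mathbf A(\mathscr M)$; (ii) $\mathscr M$ is relatively weakly compact in the Banach space $ba(\mathcal A)$; (iii) $\{|\mu|:\mu\in\mathscr M\}$ is uniformly monotone continuous: for every monotone sequence $(A_n)$ in $\mathcal A$, $\lim_n|\mu|(A_n)$ exists uniformly in $\mu\in\mathscr M$; (iv) for each $\mathscr M_0\subset\mathscr M$ and each sequence $(A_n)$ in $\mathcal A$ such that $\lim_j\lim_k|\mu|\big(\bigcup_{n=j}^{j+k}A_n\big)=0$ for every $\mu\in\mathscr M_0$, one has $\mu(A_n)\to0$ uniformly in $\mu\in\mathscr M_0$; (v) (uniform absolute continuity property) whenever $\mathscr M_0\subset\mathscr M$, $\lambda\in ba(\mathcal A)$ and $\mu\ll\lambda$ for all $\mu\in\mathscr M_0$, then $\lim_{|\lambda|(A)\to0}\sup_{\mu\in\mathscr M_0}|\mu|(A)=0$; (vi) (uniform orthogonality property) whenever $\mathscr M_0\subset\mathscr M$, $\lambda\in ba(\mathcal A)$ and $\lambda\perp\mu$ for all $\mu\in\mathscr M_0$, then for every $\varepsilon>0$ there is $A\in\mathcal A$ with $\sup_{\mu\in\mathscr M_0}|\mu|(A)+|\lambda|(A^c)<\varepsilon$.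
   Context: $\mathcal A$ is an algebra of subsets of $\Omega$; $ba(\mathcal A)$ the Banach space of bounded finitely additive real set functions on $\mathcal A$ with $\|\mu\|=|\mu|(\Omega)$, $|\mu|$ total variation; $ca(\mathcal A)$ its countably additive elements. $\mu\ll\lambda$: for every $\varepsilon>0$ there is $\delta>0$ with $|\lambda|(A)<\delta\Rightarrow|\mu|(A)<\varepsilon$. $\mu\perp\lambda$: for every $\varepsilon>0$ there is $A\in\mathcal A$ with $|\mu|(A)+|\lambda|(A^c)<\varepsilon$. $\mathbf A(\mathscr M)=\{\sum_n\alpha_n\frac{|\mu_n|}{1\vee\|\mu_n\|}:\mu_n\in\mathscr M,\ \alpha_n\ge0,\ \sum_n\alpha_n=1\}$. *)

(* Defs.v *)
From Stdlib Require Import Reals Lra List ClassicalEpsilon.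
Open Scope R_scope.

Definition setT {Om : Type} : Om -> Prop := fun _ => True.
Definition set0 {Om : Type} : Om -> Prop := fun _ => False.
Definition setC {Om : Type} (A : Om -> Prop) : Om -> Prop := fun x => ~ A x.
Definition setU {Om : Type} (A B : Om -> Prop) : Om -> Prop := fun x => A x \/ B x.
Definition disj {Om : Type} (A B : Om -> Prop) : Prop := forall x, A x -> B x -> False.

Definition is_algebra {Om : Type} (Alg : (Om -> Prop) -> Prop) : Prop :=
  Alg set0 /\
  (forall A, Alg A -> Alg (setC A)) /\
  (forall A B, Alg A -> Alg B -> Alg (setU A B)).

Definition is_sigma_algebra {Om : Type} (Alg : (Om -> Prop) -> Prop) : Prop :=
  is_algebra Alg /\
  (forall A : nat -> Om -> Prop, (forall n, Alg (A n)) ->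
     Alg (fun x => exists n, A n x)).

(** Supremum of a set of reals (0 if empty or unbounded above). *)
Definition Rsup (E : R -> Prop) : R :=
  match excluded_middle_informative (bound E /\ exists x, E x) with
  | left h => proj1_sig (completeness E (proj1 h) (proj2 h))
  | right _ => 0
  end.

Definition setfun (Om : Type) := (Om -> Prop) -> R.

(** Elements of ba(A).  A set function is represented by a function on all
    subsets of Omega; elements of ba(A) are normalised to vanish off A, so the
    representation is canonical. *)
Definition is_ba {Om : Type} (Alg : (Om -> Prop) -> Prop) (mu : setfun Om) : Prop :=
  (forall A, ~ Alg A -> mu A = 0) /\
  (forall A B, Alg A -> Alg B -> disj A B -> mu (setU A B) = mu A + mu B) /\
  (exists K, forall A, Alg A -> Rabs (mu A) <= K).

Definition is_ca {Om : Type} (Alg : (Om -> Prop) -> Prop) (mu : setfun Om) : Prop :=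
  is_ba Alg mu /\
  (forall A : nat -> Om -> Prop,
     (forall n, Alg (A n)) ->
     (forall n m, n <> m -> disj (A n) (A m)) ->
     Alg (fun x => exists n, A n x) ->
     infinite_sum (fun n => mu (A n)) (mu (fun x => exists n, A n x))).

Definition is_partition {Om : Type} (Alg : (Om -> Prop) -> Prop)
    (A : Om -> Prop) (l : list (Om -> Prop)) : Prop :=
  Forall Alg l /\
  (forall i j, (i < j)%nat -> (j < length l)%nat -> disj (nth i l set0) (nth j l set0)) /\
  (forall x, A x <-> Exists (fun B => B x) l).

Definition tv {Om : Type} (Alg : (Om -> Prop) -> Prop) (mu : setfun Om)
    (A : Om -> Prop) : R :=
  Rsup (fun s => exists l, is_partition Alg A l /\
                   s = fold_right (fun B acc => Rabs (mu B) + acc) 0 l).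

Definition ba_norm {Om : Type} (Alg : (Om -> Prop) -> Prop) (mu : setfun Om) : R :=
  tv Alg mu setT.

Definition abs_cont {Om : Type} (Alg : (Om -> Prop) -> Prop) (mu lam : setfun Om) : Prop :=
  forall eps, 0 < eps -> exists delta, 0 < delta /\
    forall A, Alg A -> tv Alg lam A < delta -> tv Alg mu A < eps.

Definition perp {Om : Type} (Alg : (Om -> Prop) -> Prop) (mu lam : setfun Om) : Prop :=
  forall eps, 0 < eps -> exists A, Alg A /\ tv Alg mu A + tv Alg lam (setC A) < eps.

Definition sup_tv {Om : Type} (Alg : (Om -> Prop) -> Prop) (M0 : setfun Om -> Prop)
    (A : Om -> Prop) : R :=
  Rsup (fun s => exists mu, M0 mu /\ s = tv Alg mu A).

Definition in_AM {Om : Type} (Alg : (Om -> Prop) -> Prop) (M : setfun Om -> Prop)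
    (m : setfun Om) : Prop :=
  exists (mus : nat -> setfun Om) (alpha : nat -> R),
    (forall n, M (mus n)) /\ (forall n, 0 <= alpha n) /\ infinite_sum alpha 1 /\
    forall A, Alg A ->
      infinite_sum (fun n => alpha n * tv Alg (mus n) A / Rmax 1 (ba_norm Alg (mus n))) (m A).

Definition cont_lin_functional {Om : Type} (Alg : (Om -> Prop) -> Prop)
    (phi : setfun Om -> R) : Prop :=
  (forall a b mu nu, is_ba Alg mu -> is_ba Alg nu ->
     phi (fun A => a * mu A + b * nu A) = a * phi mu + b * phi nu) /\
  (exists C, forall mu, is_ba Alg mu -> Rabs (phi mu) <= C * ba_norm Alg mu).

Definition weak_nbhd {Om : Type} (Alg : (Om -> Prop) -> Prop)
    (fs : list (setfun Om -> R)) (eps : R) (x : setfun Om) : setfun Om -> Prop :=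
  fun y => is_ba Alg y /\ Forall (fun f => Rabs (f y - f x) < eps) fs.

Definition weakly_open {Om : Type} (Alg : (Om -> Prop) -> Prop)
    (U : setfun Om -> Prop) : Prop :=
  (forall x, U x -> is_ba Alg x) /\
  forall x, U x -> exists fs eps, 0 < eps /\
    Forall (cont_lin_functional Alg) fs /\
    forall y, weak_nbhd Alg fs eps x y -> U y.

Definition weak_closure {Om : Type} (Alg : (Om -> Prop) -> Prop)
    (M : setfun Om -> Prop) : setfun Om -> Prop :=
  fun x => is_ba Alg x /\
    forall fs eps, 0 < eps -> Forall (cont_lin_functional Alg) fs ->
      exists y, M y /\ weak_nbhd Alg fs eps x y.

Definition weakly_compact {Om : Type} (Alg : (Om -> Prop) -> Prop)
    (K : setfun Om -> Prop) : Prop :=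
  forall cover : (setfun Om -> Prop) -> Prop,
    (forall U, cover U -> weakly_open Alg U) ->
    (forall x, K x -> exists U, cover U /\ U x) ->
    exists l, Forall cover l /\ forall x, K x -> Exists (fun U => U x) l.

Definition rel_weakly_compact {Om : Type} (Alg : (Om -> Prop) -> Prop)
    (M : setfun Om -> Prop) : Prop :=
  weakly_compact Alg (weak_closure Alg M).

Definition cond_i {Om : Type} Alg (M : setfun Om -> Prop) : Prop :=
  exists m, in_AM Alg M m /\
    forall eps, 0 < eps -> exists delta, 0 < delta /\
      forall A, Alg A -> Rabs (m A) < delta -> sup_tv Alg M A < eps.

Definition cond_ii {Om : Type} Alg (M : setfun Om -> Prop) : Prop :=
  rel_weakly_compact Alg M.

Definition monotone_seq {Om : Type} (A : nat -> Om -> Prop) : Prop :=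
  (forall n x, A n x -> A (S n) x) \/ (forall n x, A (S n) x -> A n x).

Definition cond_iii {Om : Type} Alg (M : setfun Om -> Prop) : Prop :=
  forall A : nat -> Om -> Prop, (forall n, Alg (A n)) -> monotone_seq A ->
    exists L : setfun Om -> R, forall eps, 0 < eps -> exists N, forall n mu,
      (N <= n)%nat -> M mu -> Rabs (tv Alg mu (A n) - L mu) < eps.

Definition union_range {Om : Type} (A : nat -> Om -> Prop) (j k : nat) : Om -> Prop :=
  fun x => exists n, (j <= n <= j + k)%nat /\ A n x.

Definition cond_iv {Om : Type} Alg (M : setfun Om -> Prop) : Prop :=
  forall (M0 : setfun Om -> Prop) (A : nat -> Om -> Prop),
    (forall mu, M0 mu -> M mu) -> (forall n, Alg (A n)) ->
    (forall mu, M0 mu -> exists l : nat -> R,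
        (forall j, Un_cv (fun k => tv Alg mu (union_range A j k)) (l j)) /\ Un_cv l 0) ->
    forall eps, 0 < eps -> exists N, forall n mu,
      (N <= n)%nat -> M0 mu -> Rabs (mu (A n)) < eps.

Definition cond_v {Om : Type} Alg (M : setfun Om -> Prop) : Prop :=
  forall (M0 : setfun Om -> Prop) (lam : setfun Om),
    (forall mu, M0 mu -> M mu) -> is_ba Alg lam ->
    (forall mu, M0 mu -> abs_cont Alg mu lam) ->
    forall eps, 0 < eps -> exists delta, 0 < delta /\
      forall A, Alg A -> tv Alg lam A < delta -> sup_tv Alg M0 A < eps.

Definition cond_vi {Om : Type} Alg (M : setfun Om -> Prop) : Prop :=
  forall (M0 : setfun Om -> Prop) (lam : setfun Om),
    (forall mu, M0 mu -> M mu) -> is_ba Alg lam ->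
    (forall mu, M0 mu -> perp Alg lam mu) ->
    forall eps, 0 < eps -> exists A, Alg A /\
      sup_tv Alg M0 A + tv Alg lam (setC A) < eps.

(* Main.v *)
From mathcomp Require filter.
From Coquelicot Require Import Coquelicot.
From Stdlib Require Import Arith Reals Lra Lia List Classical ClassicalEpsilon
  FunctionalExtensionality PropExtensionality.
From Stdlib Require Cantor.
Require Import Defs.
Open Scope R_scope.

(** The hub of all the implications is the sequential condition [s_bounded]: there are no
    disjoint [A n] and members [mu n] of the family with [|mu n| (A n)] bounded away from 0.
    A limsup argument with finite intersections of finite unions shows that it forces the
    whole family to be small wherever finitely many of its members are small enough, which
    yields a control measure, (i), (iv), (v) and (vi).

    For weak compactness, a control measure [m] makes every continuous functional uniformly
    close, on the family, to integration of a simple function (approximate Radon-Nikodym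
    densities, obtained from approximate Hahn sets); so ultrafilter limits taken setwise are
    weak limits.  Conversely, a failure of [s_bounded] is turned by a gliding hump into a
    sequence in the family without weak cluster point.  For (vi), a failure of [s_bounded]
    by countably additive members gives, through a free ultrafilter, a purely finitely
    additive [lam] that is orthogonal to each of them but not uniformly. *)

(** * Ultrafilters *)

(** What shapes the argument is that an algebra offers no countable unions: limsups of sets, exact
    Hahn sets and Radon-Nikodym densities need not exist. Each is replaced by an object of the
    algebra with a tolerance, and tolerances that accumulate are geometric. [s_bounded] serves as
    the hub because its negation hands over one concrete sequence of disjoint sets and members,
    which every condition can contradict; it also passes to subfamilies, as (iv), (v) and (vi)
    require for [M0]. The weak closure of [M] has elements outside [M], so approximations are proved
    for the class [dominated], given by the bound |x|(A) <= sup of |mu|(A) over [M], which survives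
    setwise limits. The dual of ba is never described: a functional is only examined on measures
    with a density relative to [m], where it acts as a finitely additive set function bounded by a
    multiple of [m]. Countable additivity only makes the tails of a disjoint sequence negligible for
    each member; the sigma-algebra is what contains these tails. *)

Record ultrafilter {T : Type} (G : (T -> Prop) -> Prop) : Prop := {
  ultra_up : forall P Q : T -> Prop, (forall x, P x -> Q x) -> G P -> G Q;
  ultra_and : forall P Q, G P -> G Q -> G (fun x => P x /\ Q x);
  ultra_ex : forall P, G P -> exists x, P x;
  ultra_dec : forall P, G P \/ G (fun x => ~ P x) }.

Lemma ultrafilter_extension (T : Type) (F : (T -> Prop) -> Prop) :
  (forall l, Forall F l -> exists x, Forall (fun P => P x) l) ->
  exists G, ultrafilter G /\ forall P, F P -> G P.
Proof.
  intros fip.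
  set (H := fun P : T -> Prop => exists l, Forall F l /\
              forall x, Forall (fun Q => Q x) l -> P x).
  assert (PH : @filter.ProperFilter T H).
  { constructor.
    - intros [l [Fl Pl]]. destruct (fip l Fl) as [x Hx]. exact (Pl x Hx).
    - constructor.
      + exists nil. split; [constructor | intros x _; exact I].
      + intros P Q [l [Fl Pl]] [l' [Fl' Pl']]. exists (l ++ l'). split.
        * apply Forall_app; split; assumption.
        * intros x Hx. apply Forall_app in Hx. destruct Hx. split; auto.
      + intros P Q PQ [l [Fl Pl]]. exists l. split; [assumption|].
        intros x Hx. apply PQ, Pl, Hx. }
  destruct (filter.ultraFilterLemma PH) as [G [UG HG]].
  pose proof (filter.ultra_proper (UltraFilter := UG)) as PG.
  pose proof (filter.filter_filter (ProperFilter := PG)) as FG.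
  exists G. split.
  - constructor.
    + intros P Q PQ GP. exact (@filter.filterS T G FG P Q PQ GP).
    + intros P Q GP GQ. exact (@filter.filterI T G FG P Q GP GQ).
    + intros P GP. apply NNPP. intros nP.
      apply (@filter.filter_not_empty T G PG).
      apply (@filter.filterS T G FG P); [|exact GP].
      intros x Px. exact (nP (ex_intro _ x Px)).
    + intros P. exact (@filter.in_ultra_setVsetC T G P UG).
  - intros P FP. apply HG. exists (P :: nil). split; [auto|].
    intros x Hx. inversion Hx; assumption.
Qed.

(** The limit is the supremum of the r with r <= f on a set of [G]; above it, maximality of [G] puts
    the complement of l + eps/2 <= f into [G]. *)
Lemma ultralim_exists (T : Type) (G : (T -> Prop) -> Prop) (f : T -> R) (K : R) :
  ultrafilter G -> G (fun x => Rabs (f x) <= K) ->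
  exists l, forall eps, 0 < eps -> G (fun x => Rabs (f x - l) < eps).
Proof.
  intros UG HK.
  destruct (completeness (fun r => G (fun x => r <= f x))) as [l [ub lub]].
  - exists K. intros r Hr.
    destruct (ultra_ex _ UG _ (ultra_and _ UG _ _ HK Hr)) as [x [H1 H2]].
    pose proof (Rle_abs (f x)). lra.
  - exists (- K). apply (ultra_up _ UG _ _) with (2 := HK).
    intros x Hx. apply Rabs_le_between in Hx. lra.
  - exists l. intros eps He.
    assert (Hu : G (fun x => ~ l + eps / 2 <= f x)).
    { destruct (ultra_dec _ UG (fun x => l + eps / 2 <= f x)) as [H|H]; [|exact H].
      pose proof (ub _ H). lra. }
    assert (Hl : G (fun x => l - eps / 2 <= f x)).
    { apply NNPP. intros nG.
      assert (l <= l - eps / 2); [|lra].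
      apply lub. intros r Hr. apply Rnot_lt_le. intros Hlt. apply nG.
      apply (ultra_up _ UG _ _) with (2 := Hr). intros; lra. }
    apply (ultra_up _ UG _ _) with (2 := ultra_and _ UG _ _ Hu Hl).
    intros x [H1 H2]. apply Rabs_def1; lra.
Qed.

(** * Total variation on an algebra of sets *)

Definition subset {Om : Type} (A B : Om -> Prop) : Prop := forall x, A x -> B x.
Definition setI {Om : Type} (A B : Om -> Prop) : Om -> Prop := fun x => A x /\ B x.
Definition setD {Om : Type} (A B : Om -> Prop) : Om -> Prop := fun x => A x /\ ~ B x.

(** Glivenko: [tauto] is intuitionistic, but it proves the double negation of every classical
    propositional tautology, which [NNPP] then removes. *)
Ltac set_pt x :=
  repeat match goal with
    | H : subset _ _ |- _ => specialize (H x)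
    | H : disj _ _ |- _ => specialize (H x)
  end;
  cbv beta delta [setU setI setD setC setT set0] in *; apply NNPP; tauto.

Ltac sets :=
  let x := fresh "x" in
  match goal with
  | |- _ = _ =>
      apply functional_extensionality; intro x;
      apply propositional_extensionality; set_pt x
  | |- subset _ _ => intro x; set_pt x
  | |- disj _ _ => intro x; set_pt x
  end.

Lemma Rsup_ub (E : R -> Prop) (K s : R) :
  (forall t, E t -> t <= K) -> E s -> s <= Rsup E.
Proof.
  intros HK Hs. unfold Rsup.
  destruct (excluded_middle_informative _) as [h|h].
  - destruct (completeness E (proj1 h) (proj2 h)) as [l [ub lub]]; simpl. exact (ub _ Hs).
  - exfalso. apply h. split; [exists K; exact HK | exists s; exact Hs].
Qed.

Lemma Rsup_le (E : R -> Prop) (c : R) :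
  0 <= c -> (forall t, E t -> t <= c) -> Rsup E <= c.
Proof.
  intros Hc HE. unfold Rsup.
  destruct (excluded_middle_informative _) as [h|h]; [|exact Hc].
  destruct (completeness E (proj1 h) (proj2 h)) as [l [ub lub]]; simpl.
  apply lub. exact HE.
Qed.

(** Boundedness comes out of the contradiction: if no such t existed, [Rsup E - eps] would be an
    upper bound of [E], whichever value [Rsup] takes. *)
Lemma Rsup_approx (E : R -> Prop) (s eps : R) :
  0 < eps -> E s -> exists t, E t /\ Rsup E < t + eps.
Proof.
  intros He Hs. apply NNPP. intros H.
  assert (HE : forall t, E t -> t <= Rsup E - eps).
  { intros t Ht. apply Rnot_lt_le. intros Hlt. apply H. exists t. split; [exact Ht | lra]. }
  unfold Rsup in *.
  destruct (excluded_middle_informative _) as [h|h].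
  - destruct (completeness E (proj1 h) (proj2 h)) as [l [ub lub]]; simpl in *.
    assert (l <= l - eps) by (apply lub; exact HE). lra.
  - apply h. split; [exists (0 - eps); exact HE | exists s; exact Hs].
Qed.

Section Algebra.
Context {Om : Type} {Alg : (Om -> Prop) -> Prop} (hAlg : is_algebra Alg).

Lemma alg_set0 : Alg set0.
Proof. exact (proj1 hAlg). Qed.

Lemma alg_setC A : Alg A -> Alg (setC A).
Proof. exact (proj1 (proj2 hAlg) A). Qed.

Lemma alg_setU A B : Alg A -> Alg B -> Alg (setU A B).
Proof. exact (proj2 (proj2 hAlg) A B). Qed.

Lemma alg_setT : Alg setT.
Proof. replace setT with (setC (@set0 Om)) by sets. apply alg_setC, alg_set0. Qed.

Lemma alg_setI A B : Alg A -> Alg B -> Alg (setI A B).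
Proof.
  intros. replace (setI A B) with (setC (setU (setC A) (setC B))) by sets.
  apply alg_setC, alg_setU; apply alg_setC; assumption.
Qed.

Lemma alg_setD A B : Alg A -> Alg B -> Alg (setD A B).
Proof.
  intros. replace (setD A B) with (setI A (setC B)) by sets.
  apply alg_setI; [|apply alg_setC]; assumption.
Qed.
End Algebra.

Ltac algs :=
  solve [repeat first
    [ assumption | apply alg_setU | apply alg_setI | apply alg_setD | apply alg_setC
    | apply alg_set0 | apply alg_setT ]].

Section TotalVariation.
Context {Om : Type} {Alg : (Om -> Prop) -> Prop} (hAlg : is_algebra Alg).

Lemma ba_split mu A H : is_ba Alg mu -> Alg A -> Alg H ->
  mu A = mu (setI A H) + mu (setD A H).
Proof.
  intros [_ [add _]] HA HH. rewrite <- add by (solve [algs | sets]).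
  f_equal. sets.
Qed.

Lemma ba_sub mu A H : is_ba Alg mu -> Alg A -> Alg H -> subset H A ->
  mu A = mu H + mu (setD A H).
Proof.
  intros ba HA HH sub. rewrite (ba_split mu A H ba HA HH). do 2 f_equal. sets.
Qed.

Lemma ba_set0 mu : is_ba Alg mu -> mu set0 = 0.
Proof.
  intros ba. pose proof (ba_split mu set0 set0 ba (alg_set0 hAlg) (alg_set0 hAlg)) as E.
  replace (setI (@set0 Om) set0) with (@set0 Om) in E by sets.
  replace (setD (@set0 Om) set0) with (@set0 Om) in E by sets. lra.
Qed.

Lemma ba_lin a b mu nu : is_ba Alg mu -> is_ba Alg nu ->
  is_ba Alg (fun A => a * mu A + b * nu A).
Proof.
  intros [o1 [d1 [K1 b1]]] [o2 [d2 [K2 b2]]]. repeat split.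
  - intros A nA. rewrite o1, o2 by assumption. ring.
  - intros A B HA HB AB. rewrite d1, d2 by assumption. ring.
  - exists (Rabs a * K1 + Rabs b * K2). intros A HA.
    eapply Rle_trans; [apply Rabs_triang|]. rewrite !Rabs_mult.
    apply Rplus_le_compat; apply Rmult_le_compat_l; auto using Rabs_pos.
Qed.

(* [H] is the union of the blocks on which [mu] is nonnegative. *)
Lemma partition_hahn mu l A : is_ba Alg mu -> is_partition Alg A l ->
  Alg A /\ exists H, Alg H /\ subset H A /\
    fold_right (fun B acc => Rabs (mu B) + acc) 0 l = mu H - mu (setD A H).
Proof.
  intros ba. revert A. induction l as [|B l IH]; intros A [HF [Hd HU]].
  - assert (EA : A = set0).
    { apply functional_extensionality; intro x; apply propositional_extensionality.
      rewrite HU. split; [intros E; inversion E | intros []]. }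
    subst A. split; [apply (alg_set0 hAlg)|]. exists set0. split; [apply (alg_set0 hAlg)|].
    split; [sets|]. replace (setD set0 set0) with (@set0 Om) by sets.
    rewrite (ba_set0 mu ba). simpl. ring.
  - inversion HF as [|B' l' HB HFl]; subst.
    set (A' := fun x => Exists (fun C => C x) l).
    assert (P' : is_partition Alg A' l).
    { repeat split; auto.
      - intros i j Hij Hj. apply (Hd (S i) (S j)); simpl; lia. }
    destruct (IH A' P') as [HA' [H' [HH' [sub' E']]]].
    assert (dBA : disj B A').
    { intros x Bx Ax. apply Exists_exists in Ax. destruct Ax as [C [HC Cx]].
      destruct (In_nth _ _ set0 HC) as [j [Hj Ej]].
      apply (Hd 0%nat (S j)) with x; simpl; try lia; auto. rewrite Ej. exact Cx. }
    assert (EA : A = setU B A').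
    { apply functional_extensionality; intro x; apply propositional_extensionality.
      rewrite HU. rewrite Exists_cons. reflexivity. }
    clearbody A'. subst A. split; [algs|].
    simpl. rewrite E'. destruct ba as [o [add bd]].
    destruct (Rle_dec 0 (mu B)) as [pos|neg].
    + exists (setU B H'). split; [algs|]. split; [sets|].
      rewrite add by (solve [algs | sets]). rewrite Rabs_pos_eq by assumption.
      replace (setD (setU B A') (setU B H')) with (setD A' H') by sets. ring.
    + exists H'. split; [algs|]. split; [sets|].
      replace (setD (setU B A') H') with (setU B (setD A' H')) by sets.
      rewrite add by (solve [algs | sets]). rewrite Rabs_left by lra. ring.
Qed.

Lemma partition_pair A H : Alg A -> Alg H ->
  is_partition Alg A (setI A H :: setD A H :: nil).
Proof.
  intros HA HH. split; [repeat constructor; algs|]. split.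
  - intros i j Hij Hj. simpl in Hj. assert (i = 0 /\ j = 1)%nat as [-> ->] by lia. simpl. sets.
  - intros x. rewrite !Exists_cons, Exists_nil. set_pt x.
Qed.

Lemma variation_bound mu A : is_ba Alg mu -> exists K, forall s,
  (exists l, is_partition Alg A l /\
     s = fold_right (fun B acc => Rabs (mu B) + acc) 0 l) -> s <= K.
Proof.
  intros ba. pose proof ba as [_ [_ [K bd]]]. exists (2 * K). intros s [l [Pl ->]].
  destruct (partition_hahn mu l A ba Pl) as [HA [H [HH [_ ->]]]].
  pose proof (bd H HH) as B1. pose proof (bd (setD A H) (alg_setD hAlg _ _ HA HH)) as B2.
  apply Rabs_le_between in B1, B2. lra.
Qed.

Lemma tv_ub2 mu A H : is_ba Alg mu -> Alg A -> Alg H ->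
  Rabs (mu (setI A H)) + Rabs (mu (setD A H)) <= tv Alg mu A.
Proof.
  intros ba HA HH. destruct (variation_bound mu A ba) as [K HK].
  unfold tv. apply Rsup_ub with K; [exact HK|].
  exists (setI A H :: setD A H :: nil). split; [apply partition_pair; assumption|].
  simpl. ring.
Qed.

(** With [tv_ge] this replaces partitions by two-set splittings: the variation on A is the supremum
    of mu H - mu (A \ H). It need not be attained, hence eps. *)
Lemma tv_hahn mu A eps : is_ba Alg mu -> Alg A -> 0 < eps ->
  exists H, Alg H /\ subset H A /\ tv Alg mu A < mu H - mu (setD A H) + eps.
Proof.
  intros ba HA He.
  destruct (Rsup_approx (fun s => exists l, is_partition Alg A l /\
     s = fold_right (fun B acc => Rabs (mu B) + acc) 0 l)
     _ eps He (ex_intro _ _ (conj (partition_pair A A HA HA) eq_refl)))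
    as [t [[l [Pl ->]] Hs]].
  destruct (partition_hahn mu l A ba Pl) as [_ [H [HH [sub E]]]].
  exists H. split; [exact HH|]. split; [exact sub|]. rewrite E in Hs. exact Hs.
Qed.

(** A finite union of blocks lies in the algebra, so a set outside it has no partition and [Rsup]
    returns its default 0. This gives [tv] the normalisation that [is_ba] demands. *)
Lemma tv_off mu A : ~ Alg A -> tv Alg mu A = 0.
Proof.
  intros nA. unfold tv, Rsup.
  destruct (excluded_middle_informative _) as [h|h]; [|reflexivity].
  exfalso. apply nA. destruct h as [_ [s [l [[HF [_ HU]] _]]]].
  replace A with (fun x => Exists (fun B => B x) l)
    by (apply functional_extensionality; intro x; apply propositional_extensionality;
        symmetry; apply HU).
  clear HU. induction HF as [|B l HB HF IH].
  - replace (fun x : Om => Exists (fun B => B x) nil) with (@set0 Om); [apply (alg_set0 hAlg)|].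
    apply functional_extensionality; intro x; apply propositional_extensionality.
    rewrite Exists_nil. reflexivity.
  - replace (fun x : Om => Exists (fun C => C x) (B :: l))
      with (setU B (fun x => Exists (fun C => C x) l)); [algs|].
    apply functional_extensionality; intro x; apply propositional_extensionality.
    rewrite Exists_cons. reflexivity.
Qed.

Lemma tv_le mu A c : is_ba Alg mu -> Alg A ->
  (forall H, Alg H -> subset H A -> mu H - mu (setD A H) <= c) -> tv Alg mu A <= c.
Proof.
  intros ba HA Hc. apply Rnot_lt_le. intros Hlt.
  destruct (tv_hahn mu A (tv Alg mu A - c) ba HA) as [H [HH [sub E]]]; [lra|].
  specialize (Hc H HH sub). lra.
Qed.

Lemma tv_ge mu A H : is_ba Alg mu -> Alg A -> Alg H ->
  mu (setI A H) - mu (setD A H) <= tv Alg mu A.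
Proof.
  intros ba HA HH. pose proof (tv_ub2 mu A H ba HA HH).
  pose proof (Rle_abs (mu (setI A H))).
  pose proof (Rle_abs (- mu (setD A H))) as E. rewrite Rabs_Ropp in E. lra.
Qed.

Lemma tv_nonneg mu A : is_ba Alg mu -> 0 <= tv Alg mu A.
Proof.
  intros ba. destruct (classic (Alg A)) as [HA|nA].
  - pose proof (tv_ub2 mu A A ba HA HA).
    pose proof (Rabs_pos (mu (setI A A))). pose proof (Rabs_pos (mu (setD A A))). lra.
  - rewrite tv_off by assumption. lra.
Qed.

Lemma abs_le_tv mu A : is_ba Alg mu -> Rabs (mu A) <= tv Alg mu A.
Proof.
  intros ba. destruct (classic (Alg A)) as [HA|nA].
  - pose proof (tv_ub2 mu A A ba HA HA) as E.
    replace (setI A A) with A in E by sets. pose proof (Rabs_pos (mu (setD A A))). lra.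
  - rewrite (proj1 ba A nA), Rabs_R0. apply tv_nonneg, ba.
Qed.

Lemma tv_setU mu A B : is_ba Alg mu -> Alg A -> Alg B -> disj A B ->
  tv Alg mu (setU A B) = tv Alg mu A + tv Alg mu B.
Proof.
  intros ba HA HB AB. pose proof (proj1 (proj2 ba)) as add. apply Rle_antisym.
  - apply tv_le; [assumption | algs |]. intros H HH sub.
    pose proof (tv_ge mu A H ba HA HH). pose proof (tv_ge mu B H ba HB HH).
    replace H with (setU (setI A H) (setI B H)) at 1 by sets.
    replace (setD (setU A B) H) with (setU (setD A H) (setD B H)) by sets.
    rewrite !add by (solve [algs | sets]). lra.
  - apply le_epsilon. intros eps He.
    (* Near-optimal splittings of A and of B glue to a splitting of their union. *)
    destruct (tv_hahn mu A (eps / 2) ba HA) as [H [HH [sub E]]]; [lra|].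
    destruct (tv_hahn mu B (eps / 2) ba HB) as [H' [HH' [sub' E']]]; [lra|].
    pose proof (tv_ge mu (setU A B) (setU H H') ba ltac:(algs) ltac:(algs)) as G.
    replace (setI (setU A B) (setU H H')) with (setU H H') in G by sets.
    replace (setD (setU A B) (setU H H')) with (setU (setD A H) (setD B H')) in G by sets.
    rewrite !add in G by (solve [algs | sets]). lra.
Qed.

Lemma tv_is_ba mu : is_ba Alg mu -> is_ba Alg (tv Alg mu).
Proof.
  intros ba. repeat split.
  - intros A nA. apply tv_off, nA.
  - intros A B HA HB AB. apply tv_setU; assumption.
  - exists (tv Alg mu setT). intros A HA. rewrite Rabs_pos_eq by (apply tv_nonneg, ba).
    replace setT with (setU A (setC A)) by sets.
    rewrite tv_setU by (solve [algs | sets]).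
    pose proof (tv_nonneg mu (setC A) ba). lra.
Qed.

Lemma pos_mono m A B : is_ba Alg m -> (forall A, 0 <= m A) -> Alg A -> Alg B -> subset A B ->
  m A <= m B.
Proof.
  intros ba pos HA HB sub. rewrite (ba_sub m B A) by auto. pose proof (pos (setD B A)). lra.
Qed.

Lemma tv_mono mu A B : is_ba Alg mu -> Alg A -> Alg B -> subset A B ->
  tv Alg mu A <= tv Alg mu B.
Proof.
  intros ba. apply pos_mono; [apply tv_is_ba, ba | intros; apply tv_nonneg, ba].
Qed.

Lemma tv_le_norm mu A : is_ba Alg mu -> tv Alg mu A <= ba_norm Alg mu.
Proof.
  intros ba. destruct (classic (Alg A)) as [HA|nA].
  - apply tv_mono; [assumption | algs | algs | sets].
  - rewrite tv_off by assumption. apply tv_nonneg, ba.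
Qed.

Lemma tv_pos m A : is_ba Alg m -> (forall A, 0 <= m A) -> tv Alg m A = m A.
Proof.
  intros ba pos. destruct (classic (Alg A)) as [HA|nA].
  - apply Rle_antisym.
    + apply tv_le; auto. intros H HH sub. rewrite (ba_sub m A H) by auto.
      pose proof (pos (setD A H)). lra.
    + pose proof (abs_le_tv m A ba) as E. rewrite Rabs_pos_eq in E by apply pos. exact E.
  - rewrite tv_off by assumption. symmetry. apply ba, nA.
Qed.

Lemma tv_le_double mu A c : is_ba Alg mu -> Alg A ->
  (forall B, Alg B -> subset B A -> Rabs (mu B) <= c) -> tv Alg mu A <= 2 * c.
Proof.
  intros ba HA Hc. apply tv_le; auto. intros H HH sub.
  pose proof (Hc H HH sub) as B1. pose proof (Hc (setD A H) ltac:(algs) ltac:(sets)) as B2.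
  apply Rabs_le_between in B1, B2. lra.
Qed.

(** [tv_le_double] suggests the factor 2; dividing by 3 instead leaves room for a strict
    contradiction. *)
Lemma tv_witness mu A c : is_ba Alg mu -> Alg A -> 0 < c -> c <= tv Alg mu A ->
  exists B, Alg B /\ subset B A /\ c / 3 <= Rabs (mu B).
Proof.
  intros ba HA Hc Hle. apply NNPP. intros H.
  assert (tv Alg mu A <= 2 * (c / 3)); [|lra].
  apply tv_le_double; auto. intros B HB sub. apply Rnot_lt_le. intros Hlt.
  apply H. exists B. split; [exact HB|]. split; [exact sub | lra].
Qed.

(** Moving B across the boundary of a near-optimal H changes mu H - mu (A \ H) by twice mu B, and
    near-optimality forbids a gain above eps. *)
Lemma hahn_decomposition mu A eps : is_ba Alg mu -> Alg A -> 0 < eps ->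
  exists H, Alg H /\ subset H A /\
    (forall B, Alg B -> subset B H -> - eps <= mu B) /\
    (forall B, Alg B -> subset B (setD A H) -> mu B <= eps).
Proof.
  intros ba HA He. destruct (tv_hahn mu A eps ba HA He) as [H [HH [sub E]]].
  exists H. split; [exact HH|]. split; [exact sub|]. split; intros B HB subB.
  - pose proof (tv_ge mu A (setD H B) ba HA ltac:(algs)) as G.
    replace (setI A (setD H B)) with (setD H B) in G by sets.
    replace (setD A (setD H B)) with (setU B (setD A H)) in G by sets.
    rewrite (proj1 (proj2 ba)) in G by (solve [algs | sets]).
    rewrite (ba_sub mu H B ba HH HB subB) in E. lra.
  - pose proof (tv_ge mu A (setU H B) ba HA ltac:(algs)) as G.
    replace (setI A (setU H B)) with (setU H B) in G by sets.
    replace (setD A (setU H B)) with (setD (setD A H) B) in G by sets.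
    rewrite (proj1 (proj2 ba)) in G by (solve [algs | sets]).
    rewrite (ba_sub mu (setD A H) B ba ltac:(algs) HB subB) in E. lra.
Qed.

End TotalVariation.

(** * Uniform strong boundedness *)

Lemma function_choice {S T : Type} (P : S -> T -> Prop) :
  (forall s, exists t, P s t) -> exists f, forall s, P s (f s).
Proof.
  intros H. exists (fun s => proj1_sig (constructive_indefinite_description _ (H s))).
  intros s. apply proj2_sig.
Qed.

(** Dependent choice on the whole history: a step may inspect every earlier term, and [Rel] records
    how the new term relates to each of them. A history is a function of which only the values below
    n count. *)
Lemma sequence_choice {T : Type} (t0 : T) (Q : nat -> T -> Prop)
    (Rel : nat -> T -> nat -> T -> Prop) :
  (forall n (h : nat -> T), (forall i, (i < n)%nat -> Q i (h i)) ->
     exists t, Q n t /\ forall i, (i < n)%nat -> Rel i (h i) n t) ->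
  exists f, (forall n, Q n (f n)) /\ forall i n, (i < n)%nat -> Rel i (f i) n (f n).
Proof.
  intros H.
  destruct (function_choice (fun (s : nat * (nat -> T)) t =>
     (forall i, (i < fst s)%nat -> Q i (snd s i)) ->
     Q (fst s) t /\ forall i, (i < fst s)%nat -> Rel i (snd s i) (fst s) t)) as [g Hg].
  { intros [n h]; simpl.
    destruct (classic (forall i, (i < n)%nat -> Q i (h i))) as [q|nq].
    - destruct (H n h q) as [t Ht]. exists t. intros _. exact Ht.
    - exists t0. intros q. contradiction. }
  (* [hist n] holds the first n choices and the filler [t0] beyond them. *)
  set (hist := fix hist n : nat -> T := match n with
     | O => fun _ => t0
     | S k => fun i => if Nat.eqb i k then g (k, hist k) else hist k i end).
  set (f := fun n => g (n, hist n)).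
  assert (Hf : forall n i, (i < n)%nat -> hist n i = f i).
  { induction n as [|n IH]; intros i Hi; [lia|]. simpl.
    destruct (Nat.eqb_spec i n) as [->|ne]; [reflexivity | apply IH; lia]. }
  assert (HQ : forall n, Q n (f n)).
  { intros n. induction n as [n IH] using lt_wf_ind. apply (Hg (n, hist n)). simpl.
    intros i Hi. rewrite Hf by exact Hi. apply IH, Hi. }
  exists f. split; [exact HQ|]. intros i n Hi.
  destruct (Hg (n, hist n)) as [_ HR]; simpl in *.
  - intros j Hj. rewrite Hf by exact Hj. apply HQ.
  - specialize (HR i Hi). rewrite Hf in HR by exact Hi. exact HR.
Qed.

Lemma initial_segment_bounded (f : nat -> nat) (n : nat) :
  exists N, forall i, (i < n)%nat -> (f i <= N)%nat.
Proof.
  induction n as [|n [N IH]]; [exists 0%nat; intros; lia|].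
  exists (Nat.max N (f n)). intros i Hi. destruct (Nat.eq_dec i n) as [->|ne]; [lia|].
  specialize (IH i ltac:(lia)). lia.
Qed.

Lemma uniform_limit {T : Type} (M : T -> Prop) (f : T -> nat -> R) :
  (forall eps, 0 < eps -> exists N, forall n mu, (N <= n)%nat -> M mu ->
     Rabs (f mu n - f mu N) < eps) ->
  exists L : T -> R, forall eps, 0 < eps -> exists N, forall n mu,
     (N <= n)%nat -> M mu -> Rabs (f mu n - L mu) < eps.
Proof.
  intros H.
  destruct (function_choice (fun mu l => M mu -> Un_cv (f mu) l)) as [L HL].
  { intros mu. destruct (classic (M mu)) as [Mm|nM]; [|exists 0; contradiction].
    assert (C : Cauchy_crit (f mu)).
    { intros eps He. destruct (H (eps / 2)) as [N HN]; [lra|]. exists N.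
      intros n m Hn Hm. unfold Rdist.
      pose proof (HN n mu Hn Mm) as B1. pose proof (HN m mu Hm Mm) as B2.
      apply Rabs_lt_between in B1, B2. apply Rabs_lt_between. lra. }
    destruct (R_complete _ C) as [l Hl]. exists l. auto. }
  exists L. intros eps He. destruct (H (eps / 3)) as [N HN]; [lra|]. exists N.
  intros n mu Hn Mm. destruct (HL mu Mm (eps / 3) ltac:(lra)) as [N' HN'].
  pose proof (HN n mu Hn Mm) as B1.
  pose proof (HN (Nat.max N N') mu ltac:(lia) Mm) as B2.
  pose proof (HN' (Nat.max N N') ltac:(lia)) as B3. unfold Rdist in B3.
  apply Rabs_lt_between in B1, B2, B3. apply Rabs_lt_between. lra.
Qed.

Lemma archimed_mult (c K : R) : 0 < c -> exists n : nat, K < INR n * c.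
Proof.
  intros Hc. destruct (INR_unbounded (K / c)) as [n Hn]. exists n.
  apply (Rmult_lt_compat_r c) in Hn; [|exact Hc]. unfold Rdiv in Hn.
  rewrite Rmult_assoc, Rinv_l in Hn by lra. lra.
Qed.

(** * Disjoint sequences and their partial unions *)

Definition pairwise_disj {Om : Type} (A : nat -> Om -> Prop) : Prop :=
  forall i j, i <> j -> disj (A i) (A j).

Lemma pairwise_disj_lt {Om : Type} (A : nat -> Om -> Prop) :
  (forall i j, (i < j)%nat -> disj (A i) (A j)) -> pairwise_disj A.
Proof.
  intros H i j ne x Ai Aj. destruct (Nat.lt_total i j) as [l|[e|l]].
  - exact (H i j l x Ai Aj).
  - exact (ne e).
  - exact (H j i l x Aj Ai).
Qed.

Definition punion {Om : Type} (A : nat -> Om -> Prop) (n : nat) : Om -> Prop :=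
  fun x => exists i, (i < n)%nat /\ A i x.

Section PartialUnions.
Context {Om : Type} {Alg : (Om -> Prop) -> Prop} (hAlg : is_algebra Alg).
Context (A : nat -> Om -> Prop).
Context (HA : forall n, Alg (A n)).

Lemma punion_S n : punion A (S n) = setU (punion A n) (A n).
Proof.
  apply functional_extensionality; intro x; apply propositional_extensionality.
  unfold punion, setU. split.
  - intros [i [Hi Ai]]. destruct (Nat.eq_dec i n) as [->|ne]; [right; exact Ai|].
    left. exists i. split; [lia | exact Ai].
  - intros [[i [Hi Ai]]|An]; [exists i | exists n]; split; auto; lia.
Qed.

Lemma punion_0 : punion A 0 = set0.
Proof.
  apply functional_extensionality; intro x; apply propositional_extensionality.
  split; [intros [i [Hi _]]; lia | intros []].
Qed.

Lemma alg_punion n : Alg (punion A n).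
Proof.
  induction n; [rewrite punion_0; algs|]. rewrite punion_S.
  pose proof (HA n). algs.
Qed.

Lemma union_range_S j k : union_range A j (S k) = setU (union_range A j k) (A (j + S k)%nat).
Proof.
  apply functional_extensionality; intro x; apply propositional_extensionality.
  unfold union_range, setU. split.
  - intros [i [Hi Ai]]. destruct (Nat.eq_dec i (j + S k)) as [->|ne]; [right; exact Ai|].
    left. exists i. split; [lia | exact Ai].
  - intros [[i [Hi Ai]]|An]; [exists i | exists (j + S k)%nat]; split; auto; lia.
Qed.

Lemma union_range_0 j : union_range A j 0 = A j.
Proof.
  apply functional_extensionality; intro x; apply propositional_extensionality.
  unfold union_range. split.
  - intros [i [Hi Ai]]. replace j with i by lia. exact Ai.
  - intros Aj. exists j. split; [lia | exact Aj].
Qed.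

Lemma alg_union_range j k : Alg (union_range A j k).
Proof.
  induction k; [rewrite union_range_0; apply HA|]. rewrite union_range_S.
  pose proof (HA (j + S k)%nat). algs.
Qed.

Lemma tv_setU_le mu B C : is_ba Alg mu -> Alg B -> Alg C ->
  tv Alg mu (setU B C) <= tv Alg mu B + tv Alg mu C.
Proof.
  intros ba HB HC. replace (setU B C) with (setU B (setD C B)) by sets.
  rewrite (tv_setU hAlg) by (solve [algs | sets]).
  pose proof (tv_mono hAlg mu (setD C B) C ba ltac:(algs) HC ltac:(sets)). lra.
Qed.

Context (dA : pairwise_disj A).

Lemma disj_punion n : disj (punion A n) (A n).
Proof. intros x [i [Hi Ai]] An. exact (dA i n ltac:(lia) x Ai An). Qed.

Lemma ba_punion mu n : is_ba Alg mu -> mu (punion A (S n)) = mu (punion A n) + mu (A n).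
Proof.
  intros ba. rewrite punion_S.
  apply (proj1 (proj2 ba)); auto using alg_punion, disj_punion.
Qed.

(** [union_range] includes both endpoints j and j + k, whereas [punion] stops before its index,
    hence the successor. *)
Lemma union_range_punion j k :
  union_range A j k = setD (punion A (S (j + k))) (punion A j).
Proof.
  apply functional_extensionality; intro x; apply propositional_extensionality.
  unfold union_range, setD, punion. split.
  - intros [i [Hi Ai]]. split; [exists i; split; [lia | exact Ai]|].
    intros [i' [Hi' Ai']]. exact (dA i i' ltac:(lia) x Ai Ai').
  - intros [[i [Hi Ai]] n]. exists i. split; [|exact Ai]. split; [|lia].
    apply Nat.nlt_ge. intros l. apply n. exists i. auto.
Qed.

(** At most m(Omega) / c disjoint sets can have mass c or more. *)
Lemma disjoint_small m c : is_ba Alg m -> (forall B, 0 <= m B) -> 0 < c ->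
  exists n, m (A n) < c.
Proof.
  intros ba pos Hc. destruct (archimed_mult c (m setT) Hc) as [N HN].
  apply NNPP. intros H.
  assert (E : forall n, INR n * c <= m (punion A n)).
  { induction n as [|n IH].
    - simpl. rewrite Rmult_0_l. apply pos.
    - rewrite (ba_punion m n ba), S_INR.
      assert (c <= m (A n)); [|lra].
      apply Rnot_lt_le. intros l. apply H. exists n. exact l. }
  specialize (E N). pose proof (pos_mono hAlg m (punion A N) setT ba pos
     (alg_punion N) ltac:(algs) ltac:(sets)). lra.
Qed.

End PartialUnions.

Section Uniform.
Context {Om : Type} {Alg : (Om -> Prop) -> Prop} (hAlg : is_algebra Alg).

(** Uniform exhaustivity: the variations tend to 0 uniformly along every disjoint sequence. Asking
    for one index n is equivalent, since subsequences of [A] and [mu] are again admissible. *)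
Definition s_bounded (M : setfun Om -> Prop) : Prop :=
  forall (A : nat -> Om -> Prop) (mu : nat -> setfun Om) eps, 0 < eps ->
    (forall n, Alg (A n)) -> pairwise_disj A -> (forall n, M (mu n)) ->
    exists n, tv Alg (mu n) (A n) < eps.

(** A failure at every N yields successive index intervals; the increments of [A] over them are
    disjoint, and each has mass at least eps for some member. *)
Lemma s_bounded_cauchy M (A : nat -> Om -> Prop) eps :
  s_bounded M -> (forall n, Alg (A n)) -> (forall n x, A n x -> A (S n) x) -> 0 < eps ->
  exists N, forall n mu, (N <= n)%nat -> M mu -> tv Alg mu (setD (A n) (A N)) < eps.
Proof.
  intros sb HA inc He. apply NNPP. intros H.
  assert (mono : forall i j, (i <= j)%nat -> subset (A i) (A j)).
  { intros i j Hij. induction Hij; intros x Hx; auto. }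
  (* A triple (N, k, mu) records the interval from N to k; the relation makes later intervals start
     at or after k. *)
  destruct (sequence_choice (0%nat, 0%nat, fun _ => 0)
    (fun _ t => (fst (fst t) <= snd (fst t))%nat /\ M (snd t) /\
       eps <= tv Alg (snd t) (setD (A (snd (fst t))) (A (fst (fst t)))))
    (fun _ s _ t => (snd (fst s) <= fst (fst t))%nat)) as [f [Hf1 Hf2]].
  { intros n h _. destruct (initial_segment_bounded (fun i => snd (fst (h i))) n) as [N HN].
    apply NNPP. intros H'. apply H. exists N. intros k mu Hk Mm.
    apply Rnot_le_lt. intros Hle. apply H'. exists (N, k, mu). simpl. auto. }
  destruct (sb (fun k => setD (A (snd (fst (f k)))) (A (fst (fst (f k)))))
     (fun k => snd (f k)) eps He) as [n Hn].
  - intros n. apply alg_setD; auto.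
  - apply pairwise_disj_lt. intros i j Hij x [Ai _] [_ nA].
    apply nA. exact (mono _ _ (Hf2 i j Hij) x Ai).
  - intros n. apply (Hf1 n).
  - destruct (Hf1 n) as [_ [_ H1]]. lra.
Qed.

Lemma s_bounded_cauchy_decr M (A : nat -> Om -> Prop) eps :
  s_bounded M -> (forall n, Alg (A n)) -> (forall n x, A (S n) x -> A n x) -> 0 < eps ->
  exists N, forall n mu, (N <= n)%nat -> M mu -> tv Alg mu (setD (A N) (A n)) < eps.
Proof.
  intros sb HA dec He.
  destruct (s_bounded_cauchy M (fun n => setC (A n)) eps sb) as [N HN]; auto.
  - intros n. apply alg_setC; auto.
  - intros n x nA Ax. exact (nA (dec n x Ax)).
  - exists N. intros n mu Hn Mm. specialize (HN n mu Hn Mm).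
    replace (setD (A N) (A n)) with (setD (setC (A n)) (setC (A N))) by sets. exact HN.
Qed.

Section Family.
Context (M : setfun Om -> Prop).
Context (Mba : forall mu, M mu -> is_ba Alg mu).

Lemma s_bounded_iii : s_bounded M -> cond_iii Alg M.
Proof.
  intros sb A HA mono. apply uniform_limit. intros eps He.
  destruct mono as [inc|dec].
  - assert (mono : forall i j, (i <= j)%nat -> subset (A i) (A j)).
    { intros i j Hij. induction Hij; intros x Hx; auto. }
    destruct (s_bounded_cauchy M A eps sb HA inc He) as [N HN]. exists N.
    intros n mu Hn Mm. specialize (HN n mu Hn Mm).
    rewrite (ba_sub hAlg (tv Alg mu) (A n) (A N)); auto using tv_is_ba.
    pose proof (tv_nonneg hAlg mu (setD (A n) (A N)) (Mba mu Mm)).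
    rewrite Rabs_pos_eq by lra. lra.
  - assert (mono : forall i j, (i <= j)%nat -> subset (A j) (A i)).
    { intros i j Hij. induction Hij; intros x Hx; auto. }
    destruct (s_bounded_cauchy_decr M A eps sb HA dec He) as [N HN]. exists N.
    intros n mu Hn Mm. specialize (HN n mu Hn Mm).
    rewrite (ba_sub hAlg (tv Alg mu) (A N) (A n)); auto using tv_is_ba.
    pose proof (tv_nonneg hAlg mu (setD (A N) (A n)) (Mba mu Mm)).
    rewrite Rabs_left1 by lra. lra.
Qed.

Lemma iii_s_bounded : cond_iii Alg M -> s_bounded M.
Proof.
  intros c A mu eps He HA dA Hmu.
  (* The partial unions increase, and their increment from N to N + 1 is the mass of [A N]; the
     limit [L] cancels. *)
  destruct (c (punion A)) as [L HL].
  - intros n. apply alg_punion; auto.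
  - left. intros n x [i [Hi Ai]]. exists i. split; [lia | exact Ai].
  - destruct (HL (eps / 2)) as [N HN]; [lra|]. exists N.
    pose proof (HN N (mu N) (Nat.le_refl N) (Hmu N)) as B1.
    pose proof (HN (S N) (mu N) ltac:(lia) (Hmu N)) as B2.
    rewrite (ba_punion hAlg A HA dA (tv Alg (mu N)) N) in B2 by auto using tv_is_ba.
    apply Rabs_lt_between in B1, B2. lra.
Qed.

(* The sets [G n] are finite intersections standing in for the limsup of [A]; they decrease and carry almost all the mass of [A n]. *)
Lemma s_bounded_limsup (A : nat -> Om -> Prop) eps :
  s_bounded M -> (forall n, Alg (A n)) ->
  (forall mu eta, M mu -> 0 < eta -> exists J, forall j k, (J <= j)%nat ->
     tv Alg mu (union_range A j k) <= eta) ->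
  0 < eps ->
  exists N, forall n mu, (N <= n)%nat -> M mu -> tv Alg mu (A n) < eps.
Proof.
  intros sb HA small He.
  set (B := union_range A).
  assert (HB : forall j k, Alg (B j k)) by (intros; apply alg_union_range; auto).
  assert (monoB : forall j k k', (k <= k')%nat -> subset (B j k) (B j k')).
  { intros j k k' Hk x [i [Hi Ai]]. exists i. split; [lia | exact Ai]. }
  (* From [K j] on, the increasing unions [B j k] gain almost no mass, uniformly over the family;
     the errors eps/8 * 2^-j add up to less than eps/4. *)
  assert (exists K : nat -> nat, forall j k mu, (K j <= k)%nat -> M mu ->
            tv Alg mu (setD (B j k) (B j (K j))) < eps / 8 * (1 / 2) ^ j) as [K HK].
  { apply (function_choice (fun j N => forall k mu, (N <= k)%nat -> M mu ->
            tv Alg mu (setD (B j k) (B j N)) < eps / 8 * (1 / 2) ^ j)).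
    intros j. apply s_bounded_cauchy; auto.
    - intros n x. apply monoB. lia.
    - apply Rmult_lt_0_compat; [lra | apply pow_lt; lra]. }
  set (G := fun n x => forall i, (i <= n)%nat -> B i (K i) x).
  assert (GS : forall n, G (S n) = setI (G n) (B (S n) (K (S n)))).
  { intros n. apply functional_extensionality; intro x; apply propositional_extensionality.
    unfold G, setI. split.
    - intros H. split; [intros i Hi|]; apply H; lia.
    - intros [H1 H2] i Hi. destruct (Nat.eq_dec i (S n)) as [->|ne]; [exact H2 | apply H1; lia]. }
  assert (G0 : G 0%nat = B 0%nat (K 0%nat)).
  { apply functional_extensionality; intro x; apply propositional_extensionality.
    unfold G. split; [intros H; apply H; lia|].
    intros H i Hi. replace i with 0%nat by lia. exact H. }
  assert (HG : forall n, Alg (G n)).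
  { induction n; [rewrite G0; apply HB | rewrite GS].
    pose proof (HB (S n) (K (S n))). algs. }
  assert (out : forall n i mu, (i <= n)%nat -> M mu ->
            tv Alg mu (setD (A n) (B i (K i))) <= eps / 8 * (1 / 2) ^ i).
  { intros n i mu Hi Mm.
    pose proof (HK i (Nat.max (K i) (n - i)) mu ltac:(lia) Mm) as E.
    eapply Rle_trans; [|apply Rlt_le, E].
    apply (tv_mono hAlg); [auto | apply alg_setD; auto | apply alg_setD; auto |].
    intros x [Ax nB]. split; [|exact nB]. exists n. split; [lia | exact Ax]. }
  assert (outG : forall n j mu, (j <= n)%nat -> M mu ->
            tv Alg mu (setD (A n) (G j)) <= eps / 8 * (2 - (1 / 2) ^ j)).
  { intros n j mu Hj Mm. induction j as [|j IH].
    - rewrite G0. pose proof (out n 0%nat mu Hj Mm). simpl in *. lra.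
    - specialize (IH ltac:(lia)). pose proof (out n (S j) mu Hj Mm) as E.
      pose proof (tv_setU_le hAlg mu (setD (A n) (G j)) (setD (A n) (B (S j) (K (S j))))
        (Mba mu Mm) (alg_setD hAlg _ _ (HA n) (HG j)) (alg_setD hAlg _ _ (HA n) (HB _ _))) as F.
      rewrite GS.
      replace (setD (A n) (setI (G j) (B (S j) (K (S j))))) with
        (setU (setD (A n) (G j)) (setD (A n) (B (S j) (K (S j))))) by sets.
      simpl in *. lra. }
  destruct (s_bounded_cauchy_decr M G (eps / 8) sb HG) as [N HN]; [|lra|].
  { intros n. rewrite GS. intros x [H _]. exact H. }
  (* For one mu the mass of [G n] becomes small at an index depending on mu; the uniform Cauchy
     property of the decreasing [G] carries the bound back to the common index N. *)
  assert (GN : forall mu, M mu -> tv Alg mu (G N) <= eps / 4).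
  { intros mu Mm. destruct (small mu (eps / 8) Mm ltac:(lra)) as [J HJ].
    set (n := Nat.max N J).
    assert (sub : subset (G n) (B n (K n))) by (intros x Hx; apply Hx; lia).
    pose proof (HJ n (K n) ltac:(lia)) as E1.
    pose proof (tv_mono hAlg mu (G n) _ (Mba mu Mm) (HG n) (HB n (K n)) sub) as E2.
    pose proof (HN n mu ltac:(lia) Mm) as E3.
    rewrite (ba_split hAlg (tv Alg mu) (G N) (G n)) by auto using tv_is_ba.
    pose proof (tv_mono hAlg mu (setI (G N) (G n)) (G n) (Mba mu Mm)
      (alg_setI hAlg _ _ (HG N) (HG n)) (HG n) ltac:(sets)).
    fold B in E1. lra. }
  exists N. intros n mu Hn Mm.
  rewrite (ba_split hAlg (tv Alg mu) (A n) (G N)) by auto using tv_is_ba.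
  pose proof (tv_mono hAlg mu (setI (A n) (G N)) (G N) (Mba mu Mm)
      (alg_setI hAlg _ _ (HA n) (HG N)) (HG N) ltac:(sets)).
  pose proof (GN mu Mm). pose proof (outG n N mu Hn Mm).
  assert (0 < eps / 8 * (1 / 2) ^ N) by (apply Rmult_lt_0_compat; [lra | apply pow_lt; lra]).
  lra.
Qed.

(** A version of (i) with one finite list for each eps. The lists for eps = 2^-p are later merged
    into a series, while (v) and (vi) use a single list directly. *)
Definition finitely_controlled : Prop :=
  forall eps, 0 < eps -> exists F, Forall M F /\ exists delta, 0 < delta /\
    forall A, Alg A -> Forall (fun mu => tv Alg mu A < delta) F ->
      forall mu, M mu -> tv Alg mu A <= eps.
End Family.

Lemma s_bounded_subset (M M0 : setfun Om -> Prop) :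
  (forall mu, M0 mu -> M mu) -> s_bounded M -> s_bounded M0.
Proof. intros sub sb A mu eps He HA dA Hmu. apply (sb A mu eps); auto. Qed.

(** Otherwise choose [A n] and [mu n] in turn, the earlier members having mass below 2^-n on [A n]
    and [mu n] more than eps. Each fixed member then has summable masses, so [s_bounded_limsup],
    applied to the family of the [mu n], contradicts the choice at n = N. *)
Lemma s_bounded_finitely_controlled M :
  (forall mu, M mu -> is_ba Alg mu) -> s_bounded M -> finitely_controlled M.
Proof.
  intros Mba sb eps He. apply NNPP. intros H.
  destruct (sequence_choice (@set0 Om, fun _ => 0)
    (fun _ t => Alg (fst t) /\ M (snd t) /\ eps < tv Alg (snd t) (fst t))
    (fun _ s n t => tv Alg (snd s) (fst t) < (1 / 2) ^ n)) as [f [Hf1 Hf2]].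
  { intros n h Hh. apply NNPP. intros H'. apply H.
    exists (map (fun i => snd (h i)) (seq 0 n)). split.
    { apply Forall_forall. intros mu Hmu. apply in_map_iff in Hmu.
      destruct Hmu as [i [<- Hi]]. apply in_seq in Hi. apply Hh. lia. }
    exists ((1 / 2) ^ n). split; [apply pow_lt; lra|]. intros A HA HF mu Mm.
    apply Rnot_lt_le. intros Hlt. apply H'. exists (A, mu). simpl. split; [auto|].
    intros i Hi. rewrite Forall_forall in HF. apply HF.
    apply in_map_iff. exists i. split; [reflexivity | apply in_seq; lia]. }
  set (A := fun n => fst (f n)). set (mu := fun n => snd (f n)).
  set (M0 := fun nu => exists n, nu = mu n).
  assert (HA : forall n, Alg (A n)) by (intros n; apply (Hf1 n)).
  assert (Hmu : forall n, M (mu n)) by (intros n; apply (Hf1 n)).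
  assert (sub : forall nu, M0 nu -> M nu) by (intros nu [n ->]; apply Hmu).
  destruct (s_bounded_limsup M0 (fun nu Hnu => Mba nu (sub nu Hnu)) A eps) as [N HN]; auto.
  - exact (s_bounded_subset M M0 sub sb).
  - intros nu eta [i ->] Heta.
    (* From index i + 1 on, [A n] was chosen with [mu i] in view; the tail from j then has mass
       below 2 * 2^-j, hence eta / 2. *)
    destruct (pow_lt_1_zero (1 / 2) ltac:(rewrite Rabs_pos_eq; lra) (eta / 2) ltac:(lra)) as [J HJ].
    exists (Nat.max J (S i)). intros j k Hj.
    assert (E : tv Alg (mu i) (union_range A j k) <= (1 / 2) ^ j * (2 - (1 / 2) ^ k)).
    { assert (B : forall n, (j <= n)%nat -> tv Alg (mu i) (A n) <= (1 / 2) ^ n).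
      { intros n Hn. apply Rlt_le, Hf2. lia. }
      induction k as [|k IH].
      - rewrite union_range_0. pose proof (B j (Nat.le_refl j)). simpl. lra.
      - rewrite union_range_S.
        pose proof (tv_setU_le hAlg (mu i) (union_range A j k) (A (j + S k)%nat)
          (Mba _ (Hmu i)) (alg_union_range hAlg A HA j k) (HA _)).
        pose proof (B (j + S k)%nat ltac:(lia)) as Bk.
        rewrite pow_add in Bk. simpl in *. lra. }
    pose proof (HJ j ltac:(lia)) as Ej.
    assert (P : 0 < (1 / 2) ^ j) by (apply pow_lt; lra).
    assert (P' : 0 < (1 / 2) ^ k) by (apply pow_lt; lra).
    rewrite Rabs_pos_eq in Ej by lra. nra.
  - pose proof (HN N (mu N) (Nat.le_refl N) (ex_intro _ N eq_refl)) as E.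
    destruct (Hf1 N) as [_ [_ E']]. unfold A, mu in E. lra.
Qed.

End Uniform.

(** * Conditions (i), (iv), (v) and (vi) *)

Lemma Series_ge_term (a : nat -> R) n :
  (forall k, 0 <= a k) -> ex_series a -> a n <= Series a.
Proof.
  intros pos ex. pose proof (Series_correct a ex) as H.
  apply Rle_trans with (sum_n a n).
  - destruct n; [rewrite sum_O; lra|]. rewrite sum_Sn.
    assert (0 <= sum_n a n); [|unfold plus; simpl; lra].
    induction n as [|n IH]; [rewrite sum_O; apply pos|].
    rewrite sum_Sn. pose proof (pos (S n)). unfold plus; simpl. lra.
  - apply (is_lim_seq_incr_compare (sum_n a) (Series a) H). intros k.
    rewrite sum_Sn. pose proof (pos (S k)). unfold plus; simpl. lra.
Qed.

Lemma ex_series_dominated (a c : nat -> R) :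
  (forall n, 0 <= a n) -> (forall n, a n <= c n) -> ex_series c -> ex_series a.
Proof.
  intros pos le. apply (@ex_series_le R_AbsRing R_CompleteNormedModule).
  intros n. unfold norm; simpl. unfold abs; simpl. rewrite Rabs_pos_eq; auto.
Qed.

Lemma is_series_half : is_series (fun n => (1 / 2) ^ S n) 1.
Proof.
  pose proof (is_series_geom (1 / 2) ltac:(rewrite Rabs_pos_eq; lra)) as H.
  apply (is_series_scal_l (1 / 2)) in H.
  change (is_series (fun n => (1 / 2) ^ S n) (1 / 2 * / (1 - 1 / 2))) in H.
  replace (1 / 2 * / (1 - 1 / 2)) with 1 in H by field. exact H.
Qed.

Section Sums.
Context {Om : Type} {Alg : (Om -> Prop) -> Prop} (hAlg : is_algebra Alg).

Lemma ba_scal a (mu : setfun Om) : is_ba Alg mu -> is_ba Alg (fun A => a * mu A).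
Proof.
  intros ba. replace (fun A => a * mu A) with (fun A => a * mu A + 0 * mu A).
  - apply ba_lin; assumption.
  - apply functional_extensionality. intros A. ring.
Qed.

Lemma series_ba (nu : nat -> setfun Om) (c : nat -> R) :
  (forall n, is_ba Alg (nu n)) -> (forall n A, 0 <= nu n A) ->
  (forall n A, nu n A <= c n) -> ex_series c ->
  is_ba Alg (fun A => Series (fun n => nu n A)).
Proof.
  intros ba pos le ex.
  assert (exA : forall A, ex_series (fun n => nu n A)).
  { intros A. apply ex_series_dominated with c; auto. }
  repeat split.
  - intros A nA. rewrite (Series_ext _ (fun _ => 0)).
    + apply is_series_unique, is_series_Reals. intros eps He. exists 0%nat. intros n _.
      unfold Rdist. replace (sum_f_R0 (fun _ => 0) n) with 0.
      * rewrite Rminus_0_r, Rabs_R0. exact He.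
      * induction n; simpl; [reflexivity | lra].
    + intros n. apply (ba n), nA.
  - intros A B HA HB AB. rewrite <- Series_plus by auto. apply Series_ext. intros n.
    apply (ba n); auto.
  - exists (Series c). intros A HA. rewrite Rabs_pos_eq.
    + apply Series_le; auto.
    + apply Rle_trans with (nu 0%nat A); [apply pos|].
      apply (Series_ge_term (fun n => nu n A)); auto.
Qed.

Lemma common_delta {T : Type} (w : setfun Om) (P : T -> (Om -> Prop) -> Prop) (l : list T) :
  Forall (fun t => exists d, 0 < d /\ forall A, Alg A -> w A < d -> P t A) l ->
  exists d, 0 < d /\ forall A, Alg A -> w A < d -> Forall (fun t => P t A) l.
Proof.
  induction 1 as [|t l [d [Hd H]] _ [d' [Hd' H']]].
  - exists 1. split; [lra | auto].
  - exists (Rmin d d'). split; [apply Rmin_glb_lt; assumption|].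
    intros A HA Hw. pose proof (Rmin_l d d'). pose proof (Rmin_r d d').
    constructor; [apply H | apply H']; auto; lra.
Qed.
End Sums.

Section Conditions.
Context {Om : Type} {Alg : (Om -> Prop) -> Prop} (hAlg : is_algebra Alg).
Context (M : setfun Om -> Prop).
Context (Mba : forall mu, M mu -> is_ba Alg mu).
Context (K : R).
Context (MK : forall mu, M mu -> ba_norm Alg mu <= K).

Lemma sup_tv_ub (M0 : setfun Om -> Prop) mu A :
  (forall mu, M0 mu -> M mu) -> M0 mu -> tv Alg mu A <= sup_tv Alg M0 A.
Proof.
  intros sub Hmu. apply Rsup_ub with K.
  - intros t [nu [Hnu ->]]. apply Rle_trans with (ba_norm Alg nu); auto.
    apply tv_le_norm; auto.
  - exists mu. auto.
Qed.

Lemma sup_tv_le (M0 : setfun Om -> Prop) A c :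
  0 <= c -> (forall mu, M0 mu -> tv Alg mu A <= c) -> sup_tv Alg M0 A <= c.
Proof. intros Hc H. apply Rsup_le; [exact Hc|]. intros t [mu [Hmu ->]]. auto. Qed.

Lemma s_bounded_iv : s_bounded (Alg := Alg) M -> cond_iv Alg M.
Proof.
  intros sb M0 A sub HA H eps He.
  destruct (s_bounded_limsup hAlg M0 (fun mu h => Mba mu (sub mu h)) A eps
    (s_bounded_subset M M0 sub sb) HA) as [N HN]; auto.
  - intros mu eta Hmu Heta. destruct (H mu Hmu) as [l [Hl Hl0]].
    destruct (Hl0 (eta) Heta) as [J HJ]. exists J. intros j k Hj.
    specialize (HJ j Hj). unfold Rdist in HJ. apply Rabs_lt_between in HJ.
    (* The masses increase with k, so their limit [l j] dominates them: the iterated limit becomes a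
       bound for all k at once. *)
    assert (tv Alg mu (union_range A j k) <= l j); [|lra].
    apply (is_lim_seq_incr_compare (fun k => tv Alg mu (union_range A j k))).
    + apply is_lim_seq_Reals, Hl.
    + intros n. apply (tv_mono hAlg); [auto | apply alg_union_range; auto | apply alg_union_range; auto |].
      intros x [i [Hi Ai]]. exists i. split; [lia | exact Ai].
  - exists N. intros n mu Hn Hmu. apply Rle_lt_trans with (tv Alg mu (A n)); auto.
    apply abs_le_tv; auto.
Qed.

Lemma tv_punion_converges mu (A : nat -> Om -> Prop) :
  is_ba Alg mu -> (forall n, Alg (A n)) ->
  exists U, Un_cv (fun n => tv Alg mu (punion A n)) U.
Proof.
  intros ba HA. destruct (growing_cv (fun n => tv Alg mu (punion A n))) as [U HU].
  - intros n. apply (tv_mono hAlg); [auto | apply alg_punion; auto | apply alg_punion; auto |].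
    intros x [i [Hi Ai]]. exists i. split; [lia | exact Ai].
  - exists (ba_norm Alg mu). intros t [n ->]. apply tv_le_norm; auto.
  - exists U. exact HU.
Qed.

(** For disjoint sets the hypothesis of (iv) is automatic: with [U] the limiting mass of the partial
    unions, the tail from j has mass [U] minus that of the first j sets. *)
Lemma disjoint_tail_limit mu (A : nat -> Om -> Prop) :
  is_ba Alg mu -> (forall n, Alg (A n)) -> pairwise_disj A ->
  exists l : nat -> R,
    (forall j, Un_cv (fun k => tv Alg mu (union_range A j k)) (l j)) /\ Un_cv l 0.
Proof.
  intros ba HA dA. destruct (tv_punion_converges mu A ba HA) as [U HU].
  exists (fun j => U - tv Alg mu (punion A j)). split.
  - intros j eps He. destruct (HU eps He) as [N HN]. exists N. intros k Hk.
    rewrite union_range_punion by exact dA.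
    specialize (HN (S (j + k)) ltac:(lia)). unfold Rdist in *.
    rewrite (ba_sub hAlg (tv Alg mu) (punion A (S (j + k))) (punion A j)) in HN;
      try (apply tv_is_ba; auto); [|apply alg_punion; auto|apply alg_punion; auto|].
    + replace (tv Alg mu (setD (punion A (S (j + k))) (punion A j)) -
        (U - tv Alg mu (punion A j))) with
      (tv Alg mu (punion A j) + tv Alg mu (setD (punion A (S (j + k))) (punion A j)) - U) by ring.
      exact HN.
    + intros x [i [Hi Ai]]. exists i. split; [lia | exact Ai].
  - intros eps He. destruct (HU eps He) as [N HN]. exists N. intros k Hk.
    specialize (HN k Hk). unfold Rdist in *. rewrite Rabs_minus_sym in HN.
    rewrite Rminus_0_r. exact HN.
Qed.

(** Condition (iv) and the weak topology see values mu(B) rather than variations; passing to subsets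
    keeps disjointness and costs a factor 3. *)
Lemma shrink_disjoint (A : nat -> Om -> Prop) (mu : nat -> setfun Om) eps :
  (forall n, Alg (A n)) -> pairwise_disj A -> (forall n, M (mu n)) -> 0 < eps ->
  (forall n, eps <= tv Alg (mu n) (A n)) ->
  exists B, (forall n, Alg (B n)) /\ pairwise_disj B /\
    forall n, eps / 3 <= Rabs (mu n (B n)).
Proof.
  intros HA dA Hmu He H.
  destruct (function_choice (fun n B => Alg B /\ subset B (A n) /\
     eps / 3 <= Rabs (mu n B))) as [B HB].
  { intros n. apply tv_witness; auto. }
  exists B. split; [intros n; apply HB|]. split; [|intros n; apply HB].
  intros i j ne x Bi Bj. exact (dA i j ne x (proj1 (proj2 (HB i)) x Bi)
    (proj1 (proj2 (HB j)) x Bj)).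
Qed.

Lemma iv_s_bounded : cond_iv Alg M -> s_bounded (Alg := Alg) M.
Proof.
  intros iv A mu eps He HA dA Hmu. apply NNPP. intros H.
  destruct (shrink_disjoint A mu eps HA dA Hmu He) as [B [HB [dB Hlow]]].
  { intros n. apply Rnot_lt_le. intros l. apply H. exists n. exact l. }
  destruct (iv M B) with (eps := eps / 3) as [N HN]; auto; [|lra|].
  - intros nu Hnu. apply disjoint_tail_limit; auto.
  - pose proof (HN N (mu N) (Nat.le_refl N) (Hmu N)). pose proof (Hlow N). lra.
Qed.

(** Retains from (i) the uniform absolute continuity with respect to a positive element of ba and
    forgets the series. Positivity on all sets lets [tv_pos] identify m with its variation. *)
Definition control (m : setfun Om) : Prop :=
  is_ba Alg m /\ (forall A, 0 <= m A) /\
  forall eps, 0 < eps -> exists delta, 0 < delta /\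
    forall A, Alg A -> m A < delta -> sup_tv Alg M A < eps.

Lemma weighted_tv_le alpha mu A : M mu -> 0 <= alpha ->
  0 <= alpha * tv Alg mu A / Rmax 1 (ba_norm Alg mu) <= alpha.
Proof.
  intros Hmu Ha. pose proof (tv_nonneg hAlg mu A (Mba mu Hmu)) as T0.
  pose proof (tv_le_norm hAlg mu A (Mba mu Hmu)) as T1.
  pose proof (Rmax_l 1 (ba_norm Alg mu)) as R1. pose proof (Rmax_r 1 (ba_norm Alg mu)) as R2.
  assert (E : 0 <= tv Alg mu A / Rmax 1 (ba_norm Alg mu) <= 1).
  { split; [apply Rdiv_le_0_compat; lra|]. apply Rle_div_l; lra. }
  unfold Rdiv in *. rewrite Rmult_assoc. split; nra.
Qed.

Lemma weighted_tv_ba alpha mu : M mu ->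
  is_ba Alg (fun A => alpha * tv Alg mu A / Rmax 1 (ba_norm Alg mu)).
Proof.
  intros Hmu.
  replace (fun A => alpha * tv Alg mu A / Rmax 1 (ba_norm Alg mu)) with
    (fun A => alpha / Rmax 1 (ba_norm Alg mu) * tv Alg mu A).
  - apply ba_scal, tv_is_ba; auto.
  - apply functional_extensionality. intros A. unfold Rdiv. ring.
Qed.

(** The finite lists for the tolerances 2^-p are merged into one sequence by the Cantor pairing of
    (p, i), with weights 2^-(n+1) of sum 1. *)
Lemma finitely_controlled_i :
  (exists mu, M mu) -> finitely_controlled (Alg := Alg) M -> cond_i Alg M.
Proof.
  intros [mu0 Hmu0] fc.
  destruct (function_choice (fun p (Fd : list (setfun Om) * R) =>
    Forall M (fst Fd) /\ 0 < snd Fd /\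
    forall A, Alg A -> Forall (fun mu => tv Alg mu A < snd Fd) (fst Fd) ->
      forall mu, M mu -> tv Alg mu A <= (1 / 2) ^ p)) as [Fd HFd].
  { intros p. destruct (fc ((1 / 2) ^ p)) as [F [HF [d [Hd H]]]]; [apply pow_lt; lra|].
    exists (F, d). simpl. auto. }
  (* [mu0] fills the positions beyond the end of list p, so that every index names a member of
     [M]. *)
  set (mus := fun n => let (p, i) := Cantor.of_nat n in nth i (fst (Fd p)) mu0).
  assert (Hmus : forall n, M (mus n)).
  { intros n. unfold mus. destruct (Cantor.of_nat n) as [p i].
    destruct (nth_in_or_default i (fst (Fd p)) mu0) as [I| ->]; [|exact Hmu0].
    destruct (HFd p) as [HF _]. rewrite Forall_forall in HF. auto. }
  set (alpha := fun n => (1 / 2) ^ S n).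
  assert (Ha : forall n, 0 < alpha n) by (intros n; apply pow_lt; lra).
  set (a := fun A n => alpha n * tv Alg (mus n) A / Rmax 1 (ba_norm Alg (mus n))).
  assert (Hb : forall A n, 0 <= a A n <= alpha n).
  { intros A n. apply weighted_tv_le; auto. apply Rlt_le, Ha. }
  assert (ex : forall A, ex_series (a A)).
  { intros A. apply ex_series_dominated with alpha; try apply Hb.
    exists 1. apply is_series_half. }
  exists (fun A => Series (a A)). split.
  { exists mus, alpha. repeat split; auto.
    - intros n. apply Rlt_le, Ha.
    - apply is_series_Reals, is_series_half.
    - intros A _. apply is_series_Reals, Series_correct, ex. }
  intros eps He.
  destruct (pow_lt_1_zero (1 / 2) ltac:(rewrite Rabs_pos_eq; lra) eps He) as [p Hp].
  specialize (Hp p (Nat.le_refl p)).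
  rewrite Rabs_pos_eq in Hp by (apply pow_le; lra).
  destruct (HFd p) as [HF [Hd H]]. set (d := snd (Fd p)) in *.
  destruct (common_delta (Alg := Alg) (fun A => Rabs (Series (a A)))
    (fun mu A => tv Alg mu A < d) (fst (Fd p))) as [delta [Hdelta HD]].
  { apply Forall_forall. intros mu Hin.
    destruct (In_nth _ _ mu0 Hin) as [i [Hi Ei]].
    set (n := Cantor.to_nat (p, i)).
    assert (En : mus n = mu) by (unfold mus, n; rewrite Cantor.cancel_of_to; exact Ei).
    pose proof (Rmax_l 1 (ba_norm Alg mu)) as R1.
    (* The term of index n is at most the whole series; cancelling its weight and normalisation
       gives |mu|(A) < d. *)
    exists (alpha n * d / Rmax 1 (ba_norm Alg mu)). split.
    { apply Rdiv_lt_0_compat; [|lra]. apply Rmult_lt_0_compat; auto. }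
    intros A HA Hlt.
    pose proof (Series_ge_term (a A) n (fun k => proj1 (Hb A k)) (ex A)) as G.
    pose proof (Rle_abs (Series (a A))) as G'.
    assert (L : a A n < alpha n * d / Rmax 1 (ba_norm Alg mu)) by lra.
    unfold a in L. rewrite En in L. unfold Rdiv in L.
    apply Rmult_lt_reg_r in L; [|apply Rinv_0_lt_compat; lra].
    apply Rmult_lt_reg_l in L; auto. }
  exists delta. split; [exact Hdelta|]. intros A HA Hlt.
  apply Rle_lt_trans with ((1 / 2) ^ p); [|exact Hp].
  apply sup_tv_le; [apply pow_le; lra|]. intros mu Hmu. apply H; auto.
Qed.

(** The [m] of (i) is prescribed on the algebra only, so it is replaced by the series itself, which
    vanishes off the algebra because [tv] does. *)
Lemma i_control : cond_i Alg M -> exists m, control m.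
Proof.
  intros [m [[mus [alpha [Hmus [Ha [Hs Hm]]]]] H]].
  set (nu := fun n A => alpha n * tv Alg (mus n) A / Rmax 1 (ba_norm Alg (mus n))).
  assert (Hb : forall n A, 0 <= nu n A <= alpha n).
  { intros n A. apply weighted_tv_le; auto. }
  assert (exa : ex_series alpha) by (exists 1; apply is_series_Reals, Hs).
  assert (pos : forall A, 0 <= Series (fun n => nu n A)).
  { intros A. apply Rle_trans with (nu 0%nat A); [apply Hb|].
    apply (Series_ge_term (fun n => nu n A)); [intros; apply Hb|].
    apply ex_series_dominated with alpha; try (intros; apply Hb). exact exa. }
  exists (fun A => Series (fun n => nu n A)). split; [|split; [exact pos|]].
  - apply series_ba with alpha; auto; try (intros; apply Hb).
    intros n. apply weighted_tv_ba. auto.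
  - intros eps He. destruct (H eps He) as [d [Hd HD]]. exists d. split; [exact Hd|].
    intros A HA Hlt. apply HD; auto.
    replace (m A) with (Series (fun n => nu n A)).
    + rewrite Rabs_pos_eq by apply pos. exact Hlt.
    + apply is_series_unique, is_series_Reals, Hm, HA.
Qed.

Lemma control_s_bounded m : control m -> s_bounded (Alg := Alg) M.
Proof.
  intros [ba [pos H]] A mu eps He HA dA Hmu. destruct (H eps He) as [d [Hd HD]].
  destruct (disjoint_small hAlg A HA dA m d ba pos Hd) as [n Hn]. exists n.
  apply Rle_lt_trans with (sup_tv Alg M (A n)); auto.
  apply sup_tv_ub; auto.
Qed.

Lemma s_bounded_v : s_bounded (Alg := Alg) M -> cond_v Alg M.
Proof.
  intros sb M0 lam sub lba ac eps He.
  destruct (s_bounded_finitely_controlled hAlg M0 (fun mu h => Mba mu (sub mu h))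
    (s_bounded_subset M M0 sub sb) (eps / 2)) as [F [HF [d [Hd H]]]]; [lra|].
  destruct (common_delta (Alg := Alg) (tv Alg lam) (fun mu A => tv Alg mu A < d) F)
    as [delta [Hdelta HD]].
  { eapply Forall_impl; [|exact HF]. intros mu Hmu. exact (ac mu Hmu d Hd). }
  exists delta. split; [exact Hdelta|]. intros A HA Hlt.
  apply Rle_lt_trans with (eps / 2); [|lra].
  apply sup_tv_le; [lra|]. intros mu Hmu. apply H; auto.
Qed.

(** Each [mu n] is absolutely continuous with respect to the sum of the 2^-(n+1) |mu n|. By (v) they
    are uniformly small where this sum is, and it is small on some set of a disjoint sequence. *)
Lemma v_s_bounded : cond_v Alg M -> s_bounded (Alg := Alg) M.
Proof.
  intros v A mu eps He HA dA Hmu.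
  set (nu := fun n B => (1 / 2) ^ S n * tv Alg (mu n) B).
  assert (Hh : forall n, 0 < (1 / 2) ^ S n) by (intros; apply pow_lt; lra).
  assert (pos : forall n B, 0 <= nu n B).
  { intros n B. apply Rmult_le_pos; [apply Rlt_le, Hh | apply tv_nonneg; auto]. }
  assert (le : forall n B, nu n B <= (1 / 2) ^ S n * K).
  { intros n B. apply Rmult_le_compat_l; [apply Rlt_le, Hh|].
    apply Rle_trans with (ba_norm Alg (mu n)); auto. apply tv_le_norm; auto. }
  assert (ex : ex_series (fun n => (1 / 2) ^ S n * K)).
  { exists (1 * K). apply is_series_scal_r, is_series_half. }
  set (lam := fun B => Series (fun n => nu n B)).
  assert (lba : is_ba Alg lam).
  { apply series_ba with (fun n => (1 / 2) ^ S n * K); auto.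
    intros n. apply ba_scal, tv_is_ba; auto. }
  assert (term : forall n B, nu n B <= lam B).
  { intros n B. apply (Series_ge_term (fun n => nu n B)); auto.
    apply ex_series_dominated with (fun n => (1 / 2) ^ S n * K); auto. }
  assert (lpos : forall B, 0 <= lam B).
  { intros B. apply Rle_trans with (nu 0%nat B); auto. }
  destruct (v (fun nu => exists n, nu = mu n) lam) with (eps := eps) as [d [Hd H]]; auto.
  - intros nu' [n ->]. auto.
  - intros nu' [n ->] e Hpe. exists ((1 / 2) ^ S n * e). split.
    { apply Rmult_lt_0_compat; auto. }
    intros B HB. rewrite (tv_pos hAlg lam B lba lpos). intros Hlt.
    apply Rmult_lt_reg_l with ((1 / 2) ^ S n); auto.
    apply Rle_lt_trans with (lam B); auto. apply term.
  - destruct (disjoint_small hAlg A HA dA lam d lba lpos Hd) as [n Hn]. exists n.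
    apply Rle_lt_trans with (sup_tv Alg (fun nu => exists n, nu = mu n) (A n)).
    + apply sup_tv_ub; [intros nu' [k ->]; auto | exists n; reflexivity].
    + apply H; auto. rewrite tv_pos; auto.
Qed.

Lemma s_bounded_vi : s_bounded (Alg := Alg) M -> cond_vi Alg M.
Proof.
  intros sb M0 lam sub lba orth eps He.
  destruct (s_bounded_finitely_controlled hAlg M0 (fun mu h => Mba mu (sub mu h))
    (s_bounded_subset M M0 sub sb) (eps / 2)) as [F [HF [d [Hd H]]]]; [lra|].
  (* The members of [F] are treated one at a time: orthogonality gives B with lam(B) and |mu|(B^c)
     small, and B is removed from A. The budget eta for lam is halved each time, while the members
     only have to meet the fixed bound d. *)
  assert (E : forall eta, 0 < eta -> exists A, Alg A /\ tv Alg lam (setC A) < eta /\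
     Forall (fun mu => tv Alg mu A < d) F).
  { clear H. induction HF as [|mu F Hmu HF IH]; intros eta Heta.
    - exists setT. split; [algs|]. split; [|constructor].
      replace (setC setT) with (@set0 Om) by sets.
      rewrite (ba_set0 hAlg (tv Alg lam)) by auto using tv_is_ba. exact Heta.
    - destruct (IH (eta / 2)) as [A [HA [lA FA]]]; [lra|].
      destruct (orth mu Hmu (Rmin d (eta / 2))) as [B [HB lB]]; [apply Rmin_glb_lt; lra|].
      pose proof (Rmin_l d (eta / 2)). pose proof (Rmin_r d (eta / 2)).
      pose proof (tv_nonneg hAlg lam B lba).
      pose proof (tv_nonneg hAlg mu (setC B) (Mba mu (sub mu Hmu))).
      exists (setD A B). split; [algs|]. split; [|constructor].
      + replace (setC (setD A B)) with (setU (setC A) B) by sets.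
        pose proof (tv_setU_le hAlg lam (setC A) B lba ltac:(algs) HB). lra.
      + pose proof (tv_mono hAlg mu (setD A B) (setC B) (Mba mu (sub mu Hmu))
          ltac:(algs) ltac:(algs) ltac:(sets)). lra.
      + rewrite Forall_forall in *. intros nu Hnu.
        pose proof (tv_mono hAlg nu (setD A B) A (Mba nu (sub nu (HF nu Hnu)))
          ltac:(algs) ltac:(algs) ltac:(sets)). specialize (FA nu Hnu). lra. }
  destruct (E (eps / 2)) as [A [HA [lA FA]]]; [lra|].
  exists A. split; [exact HA|].
  assert (sup_tv Alg M0 A <= eps / 2); [|lra].
  apply sup_tv_le; [lra|]. intros mu Hmu. apply H; auto.
Qed.

End Conditions.

(** * Control implies weak compactness *)

(** A simple function as a decision tree: [Split H s t] follows s on H and t off H. Trees are what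
    repeated bisection produces, and they avoid disjointness conditions on level sets. *)
Inductive simple (Om : Type) : Type :=
  | Const (c : R)
  | Split (H : Om -> Prop) (s t : simple Om).
Arguments Const {Om} c.
Arguments Split {Om} H s t.

(** The domain B comes last, so that [integral s mu] is itself a set function, the one with density
    s relative to mu, and can be integrated again. *)
Fixpoint integral {Om : Type} (s : simple Om) (mu : setfun Om) (B : Om -> Prop) : R :=
  match s with
  | Const c => c * mu B
  | Split H s t => integral s mu (setI B H) + integral t mu (setD B H)
  end.

Fixpoint simple_in {Om : Type} (Alg : (Om -> Prop) -> Prop) (K : R) (s : simple Om) : Prop :=
  match s with
  | Const c => Rabs c <= K
  | Split H s t => Alg H /\ simple_in Alg K s /\ simple_in Alg K t
  end.

Fixpoint shift {Om : Type} (d : R) (s : simple Om) : simple Om :=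
  match s with
  | Const c => Const (c + d)
  | Split H s t => Split H (shift d s) (shift d t)
  end.

(* Normalises a set function to vanish off the algebra, as membership in [is_ba] requires. *)
Definition restr {Om : Type} (Alg : (Om -> Prop) -> Prop) (f : setfun Om) : setfun Om :=
  fun B => if excluded_middle_informative (Alg B) then f B else 0.

Section Simple.
Context {Om : Type} {Alg : (Om -> Prop) -> Prop} (hAlg : is_algebra Alg).

Lemma restr_on f A : Alg A -> restr Alg f A = f A.
Proof.
  intros HA. unfold restr. destruct (excluded_middle_informative _); [reflexivity | contradiction].
Qed.

Lemma restr_ba f K :
  (forall A B, Alg A -> Alg B -> disj A B -> f (setU A B) = f A + f B) ->
  (forall A, Alg A -> Rabs (f A) <= K) -> is_ba Alg (restr Alg f).
Proof.
  intros add bd. repeat split.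
  - intros A nA. unfold restr. destruct (excluded_middle_informative _); [contradiction | reflexivity].
  - intros A B HA HB AB. rewrite !restr_on by algs. auto.
  - exists K. intros A HA. rewrite restr_on by exact HA. auto.
Qed.

Lemma trace_ba mu A : is_ba Alg mu -> Alg A -> is_ba Alg (restr Alg (fun B => mu (setI A B))).
Proof.
  intros ba HA. destruct ba as [_ [add [K bd]]]. apply restr_ba with K.
  - intros B C HB HC BC. replace (setI A (setU B C)) with (setU (setI A B) (setI A C)) by sets.
    apply add; solve [algs | sets].
  - intros B HB. apply bd. algs.
Qed.

Lemma integral_lin (s : simple Om) a b mu nu B :
  integral s (fun A => a * mu A + b * nu A) B = a * integral s mu B + b * integral s nu B.
Proof.
  revert B. induction s as [c|H s IHs t IHt]; intros B; simpl; [ring|].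
  rewrite IHs, IHt. ring.
Qed.

Lemma integral_trace (s : simple Om) mu H B :
  integral s (fun A => mu (setI A H)) B = integral s mu (setI B H).
Proof.
  revert B. induction s as [c|H' s IHs t IHt]; intros B; simpl; [ring|].
  rewrite IHs, IHt. f_equal; f_equal; sets.
Qed.

Lemma integral_trace_setD (s : simple Om) mu H B :
  integral s (fun A => mu (setD A H)) B = integral s mu (setD B H).
Proof.
  revert B. induction s as [c|H' s IHs t IHt]; intros B; simpl; [ring|].
  rewrite IHs, IHt. f_equal; f_equal; sets.
Qed.

(** Both sides integrate the product of s and t. In the induction the two branches of s become
    traces of set functions, over which the integral of t distributes by linearity. *)
Lemma integral_comm (s t : simple Om) mu B :
  integral s (integral t mu) B = integral t (integral s mu) B.
Proof.
  revert B. induction s as [c|H s1 IH1 s2 IH2]; intros B; simpl.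
  - replace (fun B0 => c * mu B0) with (fun B0 => c * mu B0 + 0 * mu B0)
      by (apply functional_extensionality; intros; ring).
    rewrite integral_lin. ring.
  - rewrite IH1, IH2, <- integral_trace, <- integral_trace_setD.
    rewrite <- (Rmult_1_l (integral t (fun A => integral s1 mu (setI A H)) B)).
    rewrite <- (Rmult_1_l (integral t (fun A => integral s2 mu (setD A H)) B)).
    rewrite <- integral_lin. f_equal. apply functional_extensionality. intros A. ring.
Qed.

Lemma integral_ext K s mu nu B : simple_in Alg K s -> Alg B ->
  (forall A, Alg A -> mu A = nu A) -> integral s mu B = integral s nu B.
Proof.
  intros Hs HB E. revert B HB. induction s as [c|H s IHs t IHt]; intros B HB; simpl.
  - rewrite E; auto.
  - destruct Hs as [HH [Hs Ht]]. rewrite IHs, IHt by (solve [assumption | algs]). reflexivity.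
Qed.

Lemma simple_in_le K K' s : K <= K' -> simple_in Alg K s -> simple_in Alg K' s.
Proof. intros le. induction s; simpl; [lra | tauto]. Qed.

Lemma simple_in_shift K d s : simple_in Alg K s -> simple_in Alg (K + Rabs d) (shift d s).
Proof.
  induction s as [c|H s IHs t IHt]; simpl; [|tauto].
  intros Hc. pose proof (Rabs_triang c d). lra.
Qed.

Lemma integral_shift K d s mu B : simple_in Alg K s -> is_ba Alg mu -> Alg B ->
  integral (shift d s) mu B = integral s mu B + d * mu B.
Proof.
  intros Hs ba. revert B. induction s as [c|H s IHs t IHt]; intros B HB; simpl; [ring|].
  destruct Hs as [HH [Hs Ht]]. rewrite IHs, IHt by (solve [assumption | algs]).
  rewrite (ba_split hAlg mu B H) by assumption. ring.
Qed.

Lemma integral_bound K s mu B : simple_in Alg K s -> is_ba Alg mu -> Alg B ->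
  Rabs (integral s mu B) <= K * tv Alg mu B.
Proof.
  intros Hs ba. revert B. induction s as [c|H s IHs t IHt]; intros B HB; simpl.
  - rewrite Rabs_mult. apply Rmult_le_compat; auto using Rabs_pos. apply (abs_le_tv hAlg); auto.
  - destruct Hs as [HH [Hs Ht]].
    rewrite (ba_split hAlg (tv Alg mu) B H) by (solve [assumption | apply (tv_is_ba hAlg); assumption]).
    pose proof (IHs Hs (setI B H) ltac:(algs)). pose proof (IHt Ht (setD B H) ltac:(algs)).
    eapply Rle_trans; [apply Rabs_triang|]. lra.
Qed.

Lemma integral_setU K s mu B C : simple_in Alg K s -> is_ba Alg mu -> Alg B -> Alg C -> disj B C ->
  integral s mu (setU B C) = integral s mu B + integral s mu C.
Proof.
  intros Hs ba. revert B C. induction s as [c|H s IHs t IHt]; intros B C HB HC BC; simpl.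
  - rewrite (proj1 (proj2 ba)) by assumption. ring.
  - destruct Hs as [HH [Hs Ht]].
    replace (setI (setU B C) H) with (setU (setI B H) (setI C H)) by sets.
    replace (setD (setU B C) H) with (setU (setD B H) (setD C H)) by sets.
    rewrite IHs, IHt by (solve [assumption | algs | sets]). ring.
Qed.

Lemma integral_ba K s mu : simple_in Alg K s -> is_ba Alg mu ->
  is_ba Alg (restr Alg (integral s mu)).
Proof.
  intros Hs ba. apply restr_ba with (Rmax K 0 * ba_norm Alg mu).
  - intros; apply integral_setU with K; assumption.
  - intros A HA. eapply Rle_trans; [apply (integral_bound K s mu A Hs ba HA)|].
    pose proof (tv_nonneg hAlg mu A ba). pose proof (tv_le_norm hAlg mu A ba).
    apply Rle_trans with (Rmax K 0 * tv Alg mu A).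
    + apply Rmult_le_compat_r; [assumption | apply Rmax_l].
    + apply Rmult_le_compat_l; [apply Rmax_r | assumption].
Qed.

Context (m : setfun Om).
Context (mba : is_ba Alg m).
Context (mpos : forall A, 0 <= m A).

(* Bisection of the range [[-K, K]] of the density: an approximate Hahn set of [nu] separates the values above and below 0, and [nu -/+ (K/2) m] then has density in [[-K/2, K/2]] on each half. *)
Lemma radon_nikodym_step n G nu K theta :
  Alg G -> is_ba Alg nu -> 0 <= K -> 0 < theta ->
  (forall B, Alg B -> subset B G -> Rabs (nu B) <= K * m B + theta) ->
  exists s, simple_in Alg K s /\ forall B, Alg B -> subset B G ->
    Rabs (nu B - integral s m B) <= K * (1 / 2) ^ n * m B + 2 ^ n * theta.
Proof.
  revert G nu K. induction n as [|n IH]; intros G nu K HG ba HK Ht Hb.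
  - exists (Const 0). split; [simpl; rewrite Rabs_R0; exact HK|].
    intros B HB sub. simpl. replace (nu B - 0 * m B) with (nu B) by ring.
    specialize (Hb B HB sub). lra.
  - destruct (hahn_decomposition hAlg nu G theta ba HG Ht) as [H [HH [sub [Hp Hn]]]].
    assert (half : forall d G', Alg G' -> subset G' G -> Rabs d = K / 2 ->
      (forall B, Alg B -> subset B G' -> Rabs (nu B - d * m B) <= K / 2 * m B + theta) ->
      exists s, simple_in Alg K s /\ forall B, Alg B -> subset B G' ->
        Rabs (nu B - integral s m B) <= K / 2 * (1 / 2) ^ n * m B + 2 ^ n * theta).
    { intros d G' HG' subG Hd Hb'.
      destruct (IH G' (fun A => 1 * nu A + (- d) * m A) (K / 2) HG') as [s [Hs Es]].
      - apply ba_lin; assumption.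
      - lra.
      - exact Ht.
      - intros B HB sB. replace (1 * nu B + - d * m B) with (nu B - d * m B) by ring. auto.
      - exists (shift d s). split.
        + apply simple_in_le with (K / 2 + Rabs d); [lra|]. apply simple_in_shift, Hs.
        + intros B HB sB. rewrite (integral_shift (K / 2)) by assumption.
          replace (nu B - (integral s m B + d * m B)) with
            (1 * nu B + - d * m B - integral s m B) by ring. auto. }
    destruct (half (K / 2) H HH sub) as [s [Hs Es]].
    { rewrite Rabs_pos_eq; lra. }
    { intros B HB sB. pose proof (Hp B HB sB) as L.
      pose proof (Hb B HB ltac:(sets)) as U. apply Rabs_le_between in U.
      apply Rabs_le_between. lra. }
    destruct (half (- (K / 2)) (setD G H) ltac:(algs) ltac:(sets)) as [t [Hs' Et]].
    { rewrite Rabs_Ropp, Rabs_pos_eq; lra. }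
    { intros B HB sB. pose proof (Hn B HB sB) as L.
      pose proof (Hb B HB ltac:(sets)) as U. apply Rabs_le_between in U.
      apply Rabs_le_between. lra. }
    exists (Split H s t). split; [simpl; auto|]. intros B HB sB.
    (* Both halves contribute their error, so theta doubles at each level while the bound K
       halves. *)
    pose proof (Es (setI B H) ltac:(algs) ltac:(sets)) as E1.
    pose proof (Et (setD B H) ltac:(algs) ltac:(sets)) as E2.
    simpl. rewrite (ba_split hAlg nu B H), (ba_split hAlg m B H) by assumption.
    apply Rabs_le_between in E1, E2. apply Rabs_le_between. simpl. lra.
Qed.

(** The depth n brings K * 2^-n * m(Omega) below eta/2, and theta is then taken small against 2^-n.
    It does not depend on nu, so Hahn sets of tolerance theta can be chosen afterwards. *)
Lemma radon_nikodym_approx K eta : 0 <= K -> 0 < eta ->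
  exists theta, 0 < theta /\ forall theta' G nu, Alg G -> is_ba Alg nu ->
    0 < theta' <= theta ->
    (forall B, Alg B -> subset B G -> Rabs (nu B) <= K * m B + theta') ->
    exists s, simple_in Alg K s /\ forall B, Alg B -> subset B G ->
      Rabs (nu B - integral s m B) <= eta.
Proof.
  intros HK He.
  assert (Q : 0 <= K * m setT) by (apply Rmult_le_pos; auto).
  destruct (pow_lt_1_zero (1 / 2) ltac:(rewrite Rabs_pos_eq; lra)
    (eta / 2 / (K * m setT + 1))) as [n Hn].
  { apply Rdiv_lt_0_compat; lra. }
  specialize (Hn n (Nat.le_refl n)). rewrite Rabs_pos_eq in Hn by (apply pow_le; lra).
  assert (P2 : 0 < 2 ^ n) by (apply pow_lt; lra).
  exists (eta / 2 / 2 ^ n). split; [apply Rdiv_lt_0_compat; lra|].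
  intros theta' G nu HG ba Ht Hb.
  destruct (radon_nikodym_step n G nu K theta' HG ba HK (proj1 Ht) Hb) as [s [Hs Es]].
  exists s. split; [exact Hs|]. intros B HB sB.
  eapply Rle_trans; [apply Es; assumption|].
  assert (E1 : 2 ^ n * theta' <= eta / 2).
  { apply Rle_trans with (2 ^ n * (eta / 2 / 2 ^ n)).
    - apply Rmult_le_compat_l; lra.
    - right. field. lra. }
  assert (E2 : K * (1 / 2) ^ n * m B <= eta / 2).
  { assert (P : 0 < (1 / 2) ^ n) by (apply pow_lt; lra).
    pose proof (pos_mono hAlg m B setT mba mpos HB ltac:(algs) ltac:(sets)) as mB.
    pose proof (mpos B).
    apply Rlt_div_r in Hn; [|lra].
    assert (K * m B <= K * m setT) by (apply Rmult_le_compat_l; assumption).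
    apply Rle_trans with ((1 / 2) ^ n * (K * m setT)); nra. }
  lra.
Qed.

End Simple.

Section WeakCompactness.
Context {Om : Type} {Alg : (Om -> Prop) -> Prop} (hAlg : is_algebra Alg).
Context (M : setfun Om -> Prop).
Context (Mba : forall mu, M mu -> is_ba Alg mu).
Context (L : R).
Context (ML : forall mu, M mu -> ba_norm Alg mu <= L).
Context (m : setfun Om).
Context (Mm : control (Alg := Alg) M m).

(** Contains the weak closure of [M] and is stable under setwise limits, while the control measure
    acts on it as on [M]. *)
Definition dominated (mu : setfun Om) : Prop :=
  is_ba Alg mu /\ forall A, Alg A -> tv Alg mu A <= sup_tv Alg M A.

(** Truncation: sets where mu exceeds k m or falls below -k m have small m, hence small variation;
    elsewhere |mu| <= k m up to a tolerance, and bisection gives a density, extended by 0. The bound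
    k serves all mu at once. *)
Lemma density_approx eps : 0 < eps ->
  exists k, 0 <= k /\ forall mu, dominated mu ->
    exists g, simple_in Alg k g /\ forall B, Alg B -> Rabs (mu B - integral g m B) <= eps.
Proof.
  intros He. destruct Mm as [mba [mpos ctl]].
  destruct (ctl (eps / 4)) as [d [Hd HD]]; [lra|].
  set (N := Rmax 0 (sup_tv Alg M setT)).
  assert (HN : 0 <= N) by apply Rmax_l.
  (* On an exceptional set k m(B) <= |mu B| + t <= N + 1 < N + 2 = k d, so m(B) < d. *)
  set (k := (N + 2) / d).
  assert (Hk : 0 < k) by (apply Rdiv_lt_0_compat; lra).
  exists k. split; [lra|]. intros mu [ba dom].
  destruct (radon_nikodym_approx hAlg m mba mpos k (eps / 4)) as [th [Hth RN]]; [lra|lra|].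
  set (t := Rmin 1 th).
  assert (Ht : 0 < t <= th) by (split; [apply Rmin_glb_lt; lra | apply Rmin_r]).
  assert (Ht1 : t <= 1) by apply Rmin_l.
  assert (T : Alg setT) by algs.
  assert (small : forall B, Alg B -> k * m B <= Rabs (mu B) + t -> tv Alg mu B <= eps / 4).
  { intros B HB E. apply Rle_trans with (sup_tv Alg M B); [auto|].
    apply Rlt_le, HD; [exact HB|].
    pose proof (abs_le_tv hAlg mu B ba). pose proof (tv_le_norm hAlg mu B ba) as B1.
    pose proof (dom setT T). pose proof (Rmax_r 0 (sup_tv Alg M setT)) as B2.
    unfold ba_norm in B1. fold N in B2.
    apply Rmult_lt_reg_l with k; [exact Hk|].
    replace (k * d) with (N + 2) by (unfold k; field; lra). lra. }
  (* [H1] stands for the set where mu > k m, the complement of [H2] for the one where mu < -k m. *)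
  destruct (hahn_decomposition hAlg (fun A => 1 * mu A + (- k) * m A) setT t
    (ba_lin _ _ _ _ ba mba) T (proj1 Ht)) as [H1 [HH1 [_ [P1 N1]]]].
  destruct (hahn_decomposition hAlg (fun A => 1 * mu A + k * m A) setT t
    (ba_lin _ _ _ _ ba mba) T (proj1 Ht)) as [H2 [HH2 [_ [P2 N2]]]].
  pose proof (small H1 HH1) as S1. pose proof (small (setC H2) ltac:(algs)) as S2.
  specialize (P1 H1 HH1 ltac:(sets)). specialize (N2 (setC H2) ltac:(algs) ltac:(sets)).
  destruct (RN t (setD H2 H1) mu ltac:(algs) ba Ht) as [s [Hs Es]].
  { intros B HB sB. specialize (N1 B HB ltac:(sets)). specialize (P2 B HB ltac:(sets)).
    apply Rabs_le_between. lra. }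
  exists (Split (setD H2 H1) s (Const 0)). split.
  { simpl. split; [algs|]. split; [exact Hs|]. rewrite Rabs_R0. lra. }
  intros B HB. simpl.
  specialize (Es (setI B (setD H2 H1)) ltac:(algs) ltac:(sets)).
  rewrite (ba_split hAlg mu B (setD H2 H1)) by (solve [assumption | algs]).
  pose proof (abs_le_tv hAlg mu (setD B (setD H2 H1)) ba) as E1.
  pose proof (tv_mono hAlg mu (setD B (setD H2 H1)) (setU H1 (setC H2)) ba
    ltac:(algs) ltac:(algs) ltac:(sets)) as E2.
  pose proof (tv_setU_le hAlg mu H1 (setC H2) ba HH1 ltac:(algs)) as E3.
  pose proof (Rle_abs (mu H1)).
  pose proof (Rle_abs (- mu (setC H2))) as A2. rewrite Rabs_Ropp in A2.
  specialize (S1 ltac:(lra)). specialize (S2 ltac:(lra)).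
  assert (E4 : Rabs (mu (setD B (setD H2 H1))) <= eps / 2) by lra.
  apply Rabs_le_between in E4, Es. apply Rabs_le_between. lra.
Qed.

Lemma functional_of_integral phi K s A :
  cont_lin_functional Alg phi -> simple_in Alg K s -> Alg A ->
  phi (restr Alg (fun B => integral s m (setI A B))) =
  integral s (restr Alg (fun A => phi (restr Alg (fun B => m (setI A B))))) A.
Proof.
  intros [lin _]. destruct Mm as [mba _]. revert A.
  induction s as [c|H s IHs t IHt]; intros A Hs HA; simpl.
  - rewrite restr_on by exact HA.
    replace (restr Alg (fun B => c * m (setI A B))) with
      (fun B => c * restr Alg (fun B => m (setI A B)) B + 0 * restr Alg (fun B => m (setI A B)) B).
    + rewrite lin by (apply (trace_ba hAlg); assumption). ring.
    + apply functional_extensionality. intros B. unfold restr.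
      destruct (excluded_middle_informative _); ring.
  - destruct Hs as [HH [Hs Ht]].
    rewrite <- IHs, <- IHt by (solve [assumption | algs]).
    rewrite <- (Rmult_1_l (phi (restr Alg (fun B => integral s m (setI (setI A H) B))))).
    rewrite <- (Rmult_1_l (phi (restr Alg (fun B => integral t m (setI (setD A H) B))))).
    assert (tr : forall s A, simple_in Alg K s -> Alg A ->
      is_ba Alg (restr Alg (fun B => integral s m (setI A B)))).
    { intros s' A' Hs' HA'.
      replace (restr Alg (fun B => integral s' m (setI A' B))) with
        (restr Alg (fun B => restr Alg (integral s' m) (setI A' B))).
      - apply (trace_ba hAlg); [|exact HA']. apply integral_ba with K; assumption.
      - apply functional_extensionality. intros B. unfold restr at 1 3.
        destruct (excluded_middle_informative _); [|reflexivity].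
        apply restr_on. algs. }
    rewrite <- lin by (apply tr; solve [assumption | algs]).
    f_equal. apply functional_extensionality. intros B. unfold restr.
    destruct (excluded_middle_informative _); [|ring].
    replace (setI (setI A B) H) with (setI (setI A H) B) by sets.
    replace (setD (setI A B) H) with (setI (setD A H) B) by sets. ring.
Qed.

Lemma functional_bound phi : cont_lin_functional Alg phi ->
  exists C, 0 <= C /\ forall mu, is_ba Alg mu -> Rabs (phi mu) <= C * ba_norm Alg mu.
Proof.
  intros [_ [C HC]]. exists (Rmax 0 C). split; [apply Rmax_l|]. intros mu ba.
  apply Rle_trans with (C * ba_norm Alg mu); [auto|].
  apply Rmult_le_compat_r; [apply (tv_nonneg hAlg); exact ba | apply Rmax_r].
Qed.

(* [psi A = phi (m restricted to A)] has an approximate density [f]; if [mu] has approximate density [g], then [phi mu], [int g dpsi], [int g f dm] and [int f dmu] are all close, with [f] independent of [mu]. *)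
Lemma functional_approx phi eps : cont_lin_functional Alg phi -> 0 < eps ->
  exists K f, simple_in Alg K f /\ forall mu, dominated mu ->
    Rabs (phi mu - integral f mu setT) <= eps.
Proof.
  intros Hphi He. destruct (functional_bound phi Hphi) as [C [HC bd]].
  (* Error budget: eps/4 for phi mu against phi gm, eps/2 for psi against f m under g, eps/4 for gm
     against mu under f. The + 1 in the denominators guards against C = 0 and k = 0. *)
  destruct (density_approx (eps / (8 * (C + 1)))) as [k [Hk dens]].
  { apply Rdiv_lt_0_compat; lra. }
  pose proof Hphi as [lin _]. pose proof Mm as [mba [mpos _]].
  set (psi := restr Alg (fun A => phi (restr Alg (fun B => m (setI A B))))).
  assert (T : Alg setT) by algs.
  (* The trace of m on A has norm m(A), so psi is bounded by C m outright and its density requires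
     no truncation. *)
  assert (psi_bd : forall A, Alg A -> Rabs (psi A) <= C * m A).
  { intros A HA. unfold psi. rewrite restr_on by exact HA.
    eapply Rle_trans; [apply bd, (trace_ba hAlg); assumption|]. right. f_equal.
    unfold ba_norm. rewrite (tv_pos hAlg).
    - rewrite restr_on by exact T. f_equal. sets.
    - apply (trace_ba hAlg); assumption.
    - intros B. unfold restr. destruct (excluded_middle_informative _); [auto | lra]. }
  assert (psi_ba : is_ba Alg psi).
  { apply restr_ba with (C * m setT); [exact hAlg| |].
    - intros A B HA HB AB.
      rewrite <- (Rmult_1_l (phi (restr Alg (fun B => m (setI A B))))).
      rewrite <- (Rmult_1_l (phi (restr Alg (fun B0 => m (setI B B0))))).
      rewrite <- lin by (apply (trace_ba hAlg); assumption).
      f_equal. apply functional_extensionality. intros D. unfold restr.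
      destruct (excluded_middle_informative _); [|ring].
      replace (setI (setU A B) D) with (setU (setI A D) (setI B D)) by sets.
      rewrite (proj1 (proj2 mba)) by (solve [algs | sets]). ring.
    - intros A HA. rewrite <- (restr_on (fun A => phi (restr Alg (fun B => m (setI A B)))) A HA).
      eapply Rle_trans; [apply psi_bd, HA|]. apply Rmult_le_compat_l; [exact HC|].
      apply (pos_mono hAlg); auto. sets. }
  destruct (radon_nikodym_approx hAlg m mba mpos C (eps / (4 * (k + 1)))) as [th [Hth RN]].
  { exact HC. }
  { apply Rdiv_lt_0_compat; lra. }
  destruct (RN th setT psi T psi_ba) as [f [Hf Ef]]; [lra| |].
  { intros B HB _. specialize (psi_bd B HB). lra. }
  exists C, f. split; [exact Hf|]. intros mu Hmu.
  destruct (dens mu Hmu) as [g [Hg Eg]]. destruct Hmu as [ba _].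
  set (gm := restr Alg (integral g m)). set (fm := restr Alg (integral f m)).
  assert (gm_ba : is_ba Alg gm) by (apply integral_ba with k; assumption).
  assert (fm_ba : is_ba Alg fm) by (apply integral_ba with C; assumption).
  set (d1 := fun A => 1 * mu A + (-1) * gm A).
  set (d2 := fun A => 1 * psi A + (-1) * fm A).
  assert (d1_ba : is_ba Alg d1) by (apply ba_lin; assumption).
  assert (d2_ba : is_ba Alg d2) by (apply ba_lin; assumption).
  assert (t1 : tv Alg d1 setT <= 2 * (eps / (8 * (C + 1)))).
  { apply (tv_le_double hAlg); auto. intros B HB _. unfold d1, gm.
    rewrite restr_on by exact HB.
    replace (1 * mu B + -1 * integral g m B) with (mu B - integral g m B) by ring. auto. }
  assert (t2 : tv Alg d2 setT <= 2 * (eps / (4 * (k + 1)))).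
  { apply (tv_le_double hAlg); auto. intros B HB _. unfold d2, fm.
    rewrite restr_on by exact HB.
    replace (1 * psi B + -1 * integral f m B) with (psi B - integral f m B) by ring.
    apply Ef; [exact HB | sets]. }
  assert (E1 : Rabs (phi mu - phi gm) <= C * tv Alg d1 setT).
  { replace (phi mu - phi gm) with (1 * phi mu + (-1) * phi gm) by ring.
    rewrite <- lin by assumption. apply bd, d1_ba. }
  assert (E2 : phi gm = integral g psi setT).
  { unfold psi. rewrite <- (functional_of_integral phi k) by assumption. f_equal.
    unfold gm. f_equal. apply functional_extensionality. intros B. f_equal. sets. }
  assert (E3 : Rabs (integral g psi setT - integral g fm setT) <= k * tv Alg d2 setT).
  { replace (integral g psi setT - integral g fm setT) with
      (1 * integral g psi setT + (-1) * integral g fm setT) by ring.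
    rewrite <- integral_lin. apply (integral_bound hAlg); assumption. }
  assert (E4 : integral g fm setT = integral f gm setT).
  { rewrite (integral_ext hAlg k g fm (integral f m)) by (solve [assumption | intros; apply restr_on; assumption]).
    rewrite (integral_ext hAlg C f gm (integral g m)) by (solve [assumption | intros; apply restr_on; assumption]).
    apply integral_comm. }
  assert (E5 : Rabs (integral f mu setT - integral f gm setT) <= C * tv Alg d1 setT).
  { replace (integral f mu setT - integral f gm setT) with
      (1 * integral f mu setT + (-1) * integral f gm setT) by ring.
    rewrite <- integral_lin. apply (integral_bound hAlg); assumption. }
  assert (F1 : C * tv Alg d1 setT <= eps / 4).
  { apply Rle_trans with (C * (2 * (eps / (8 * (C + 1))))).
    - apply Rmult_le_compat_l; assumption.
    - apply Rmult_le_reg_r with (C + 1); [lra|].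
      replace (C * (2 * (eps / (8 * (C + 1)))) * (C + 1)) with (C * (eps / 4)) by (field; lra).
      nra. }
  assert (F2 : k * tv Alg d2 setT <= eps / 2).
  { apply Rle_trans with (k * (2 * (eps / (4 * (k + 1))))).
    - apply Rmult_le_compat_l; assumption.
    - apply Rmult_le_reg_r with (k + 1); [lra|].
      replace (k * (2 * (eps / (4 * (k + 1)))) * (k + 1)) with (k * (eps / 2)) by (field; lra).
      nra. }
  rewrite E2 in E1. rewrite E4 in E3.
  apply Rabs_le_between in E1, E3, E5. apply Rabs_le_between. lra.
Qed.

(** Approximation at two sets suffices: the variation on A is tested by differences x P - x (A \ P),
    each of which involves only P and A \ P. *)
Lemma dominated_closed x : is_ba Alg x ->
  (forall A B eps, Alg A -> Alg B -> 0 < eps ->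
     exists y, dominated y /\ Rabs (y A - x A) < eps /\ Rabs (y B - x B) < eps) ->
  dominated x.
Proof.
  intros ba H. split; [exact ba|]. intros A HA. apply tv_le; auto. intros P HP sub.
  apply le_epsilon. intros eps He.
  destruct (H P (setD A P) (eps / 2) HP ltac:(algs) ltac:(lra)) as [y [[yba dom] [E1 E2]]].
  pose proof (tv_ge hAlg y A P yba HA HP) as G.
  replace (setI A P) with P in G by sets. specialize (dom A HA).
  apply Rabs_lt_between in E1, E2. lra.
Qed.

Lemma evaluation_functional A : cont_lin_functional Alg (fun mu => mu A).
Proof.
  split; [reflexivity|]. exists 1. intros mu ba. rewrite Rmult_1_l.
  apply Rle_trans with (tv Alg mu A); [apply (abs_le_tv hAlg) | apply (tv_le_norm hAlg)]; exact ba.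
Qed.

Lemma weak_closure_dominated x : weak_closure Alg M x -> dominated x.
Proof.
  intros [ba H]. apply dominated_closed; [exact ba|]. intros A B eps HA HB He.
  destruct (H ((fun mu => mu A) :: (fun mu => mu B) :: nil) eps He) as [y [My [yba F]]].
  - repeat constructor; try reflexivity; apply (proj2 (evaluation_functional _)).
  - inversion F as [|? ? E1 F']; subst. inversion F' as [|? ? E2 _]; subst.
    exists y. split; [|split; assumption]. split; [auto|]. intros C HC.
    apply (sup_tv_ub hAlg M Mba L ML); auto.
Qed.

(** * Setwise ultrafilter limits are weak limits *)

Section UltrafilterLimit.
Context (G : (setfun Om -> Prop) -> Prop).
Context (UG : ultrafilter G).
Context (GD : G dominated).
Context (mu0 : setfun Om).
Context (Glim : forall A eps, 0 < eps -> G (fun x => Rabs (x A - mu0 A) < eps)).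

Lemma ultralimit_dominated : dominated mu0.
Proof.
  apply dominated_closed.
  - repeat split.
    + intros A nA. apply cond_eq. intros eps He. rewrite Rminus_0_r.
      destruct (ultra_ex _ UG _ (ultra_and _ UG _ _ GD (Glim A eps He))) as [x [[ba _] E]].
      rewrite (proj1 ba A nA) in E. apply Rabs_lt_between in E. apply Rabs_lt_between. lra.
    + intros A B HA HB AB. apply cond_eq. intros eps He.
      destruct (ultra_ex _ UG _ (ultra_and _ UG _ _ GD
        (ultra_and _ UG _ _ (Glim (setU A B) (eps / 3) ltac:(lra))
        (ultra_and _ UG _ _ (Glim A (eps / 3) ltac:(lra)) (Glim B (eps / 3) ltac:(lra))))))
        as [x [[ba _] [E1 [E2 E3]]]].
      rewrite (proj1 (proj2 ba)) in E1 by assumption.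
      apply Rabs_lt_between in E1, E2, E3. apply Rabs_lt_between. lra.
    + exists (sup_tv Alg M setT + 1). intros A HA.
      destruct (ultra_ex _ UG _ (ultra_and _ UG _ _ GD (Glim A 1 ltac:(lra)))) as [x [[ba dom] E]].
      specialize (dom setT ltac:(algs)). pose proof (tv_le_norm hAlg x A ba) as B1.
      unfold ba_norm in B1. pose proof (abs_le_tv hAlg x A ba) as B2.
      assert (B3 : Rabs (x A) <= sup_tv Alg M setT) by lra.
      apply Rabs_le_between in B3. apply Rabs_lt_between in E. apply Rabs_le_between. lra.
  - intros A B eps HA HB He.
    destruct (ultra_ex _ UG _ (ultra_and _ UG _ _ GD
        (ultra_and _ UG _ _ (Glim A eps He) (Glim B eps He)))) as [x [D [E1 E2]]].
    exists x. auto.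
Qed.

Lemma ultralimit_integral s B eps : 0 < eps ->
  G (fun x => Rabs (integral s x B - integral s mu0 B) < eps).
Proof.
  revert B eps. induction s as [c|H s IHs t IHt]; intros B eps He; simpl.
  - pose proof (Rabs_pos c).
    apply (ultra_up _ UG _ _) with (2 := Glim B (eps / (Rabs c + 1)) ltac:(apply Rdiv_lt_0_compat; lra)).
    intros x E. rewrite <- Rmult_minus_distr_l, Rabs_mult.
    apply Rlt_div_r in E; [|lra]. pose proof (Rabs_pos (x B - mu0 B)). nra.
  - apply (ultra_up _ UG _ _) with (2 := ultra_and _ UG _ _
      (IHs (setI B H) (eps / 2) ltac:(lra)) (IHt (setD B H) (eps / 2) ltac:(lra))).
    intros x [E1 E2]. apply Rabs_lt_between in E1, E2. apply Rabs_lt_between. lra.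
Qed.

Lemma ultralimit_functional phi eps : cont_lin_functional Alg phi -> 0 < eps ->
  G (fun x => Rabs (phi x - phi mu0) < eps).
Proof.
  intros Hphi He.
  destruct (functional_approx phi (eps / 4) Hphi ltac:(lra)) as [K [f [Hf Ef]]].
  pose proof (Ef mu0 ultralimit_dominated) as E0.
  apply (ultra_up _ UG _ _) with (2 := ultra_and _ UG _ _ GD
    (ultralimit_integral f setT (eps / 4) ltac:(lra))).
  intros x [D E]. specialize (Ef x D).
  apply Rabs_le_between in E0, Ef. apply Rabs_lt_between in E. apply Rabs_lt_between. lra.
Qed.

Lemma ultralimit_weak_nbhd fs eps : Forall (cont_lin_functional Alg) fs -> 0 < eps ->
  G (weak_nbhd Alg fs eps mu0).
Proof.
  intros Hfs He. unfold weak_nbhd. apply (ultra_and _ UG).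
  - apply (ultra_up _ UG _ _) with (2 := GD). intros x [ba _]. exact ba.
  - induction Hfs as [|f fs Hf _ IH].
    + apply (ultra_up _ UG _ _) with (2 := GD). intros; constructor.
    + apply (ultra_up _ UG _ _) with
        (2 := ultra_and _ UG _ _ (ultralimit_functional f eps Hf He) IH).
      intros x [E1 E2]. constructor; assumption.
Qed.
End UltrafilterLimit.

(** Without a finite subcover, the closure and the complements of the cover members have the finite
    intersection property. The limit of an ultrafilter containing them lies in the closure, hence in
    some U of the cover; a weak neighbourhood inside U and the complement of U would then both
    belong to the ultrafilter. *)
Lemma control_weakly_compact : cond_ii Alg M.
Proof.
  intros cover Hopen Hcover. apply NNPP. intros H.
  destruct (ultrafilter_extension (setfun Om)
    (fun P => P = weak_closure Alg M \/ exists U, cover U /\ P = (fun x => ~ U x)))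
    as [G [UG HG]].
  { intros l Hl.
    assert (E : exists l', Forall cover l' /\ forall x, weak_closure Alg M x ->
       ~ Exists (fun U => U x) l' -> Forall (fun P => P x) l).
    { induction Hl as [|P l HP _ [l' [Hl' IH]]].
      - exists nil. split; [constructor | intros; constructor].
      - destruct HP as [-> | [U [HU ->]]].
        + exists l'. split; auto.
        + exists (U :: l'). split; [constructor; assumption|].
          intros x Hx nE. rewrite Exists_cons in nE. constructor; [tauto|]. apply IH; tauto. }
    destruct E as [l' [Hl' El]]. apply NNPP. intros nx. apply H. exists l'.
    split; [exact Hl'|]. intros x Hx. apply NNPP. intros nE. apply nx. exists x. auto. }
  assert (GK : G (weak_closure Alg M)) by (apply HG; left; reflexivity).
  assert (GD : G dominated).
  { apply (ultra_up _ UG _ _) with (2 := GK). apply weak_closure_dominated. }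
  destruct (function_choice (fun A l => forall eps, 0 < eps ->
    G (fun x : setfun Om => Rabs (x A - l) < eps))) as [mu0 Glim].
  { intros A. apply (ultralim_exists _ G (fun x => x A) (sup_tv Alg M setT) UG).
    apply (ultra_up _ UG _ _) with (2 := GD). intros x [ba dom].
    eapply Rle_trans; [apply (abs_le_tv hAlg x A ba)|].
    eapply Rle_trans; [apply (tv_le_norm hAlg x A ba)|]. apply dom. algs. }
  pose proof (ultralimit_weak_nbhd G UG GD mu0 Glim) as nbhd.
  assert (K0 : weak_closure Alg M mu0).
  { split; [apply (ultralimit_dominated G UG GD mu0 Glim)|]. intros fs eps He Hfs.
    destruct (ultra_ex _ UG _ (ultra_and _ UG _ _ GK (nbhd fs (eps / 2) Hfs ltac:(lra))))
      as [x [[_ clx] [_ Fx]]].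
    destruct (clx fs (eps / 2) ltac:(lra) Hfs) as [y [My [yba Fy]]].
    exists y. split; [exact My|]. split; [exact yba|].
    rewrite Forall_forall in *. intros f Hf. specialize (Fx f Hf). specialize (Fy f Hf).
    simpl in *. apply Rabs_lt_between in Fx, Fy. apply Rabs_lt_between. lra. }
  destruct (Hcover mu0 K0) as [U [HU U0]].
  destruct (proj2 (Hopen U HU) mu0 U0) as [fs [eps [He [Hfs sub]]]].
  assert (GnU : G (fun x => ~ U x)) by (apply HG; right; exists U; auto).
  destruct (ultra_ex _ UG _ (ultra_and _ UG _ _ GnU (nbhd fs eps Hfs He))) as [x [nU Hx]].
  exact (nU (sub x Hx)).
Qed.

End WeakCompactness.

(** * Weak compactness implies strong boundedness *)

Section DisjointSeries.
Context {Om : Type} {Alg : (Om -> Prop) -> Prop} (hAlg : is_algebra Alg).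
Context (C : nat -> Om -> Prop).
Context (HC : forall n, Alg (C n)).
Context (dC : pairwise_disj C).

Lemma disjoint_partial_sum mu n : is_ba Alg mu ->
  sum_n (fun i => Rabs (mu (C i))) n <= ba_norm Alg mu.
Proof.
  intros ba. apply Rle_trans with (tv Alg mu (punion C (S n))).
  - induction n as [|n IH].
    + rewrite sum_O, (ba_punion hAlg C HC dC (tv Alg mu)) by (apply (tv_is_ba hAlg); exact ba).
      pose proof (tv_nonneg hAlg mu (punion C 0) ba).
      pose proof (abs_le_tv hAlg mu (C 0%nat) ba). lra.
    + rewrite sum_Sn, (ba_punion hAlg C HC dC (tv Alg mu)) by (apply (tv_is_ba hAlg); exact ba).
      pose proof (abs_le_tv hAlg mu (C (S n)) ba). unfold plus; simpl. lra.
  - apply (tv_le_norm hAlg). exact ba.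
Qed.

Lemma disjoint_ex_series mu : is_ba Alg mu -> ex_series (fun i => Rabs (mu (C i))).
Proof.
  intros ba. destruct (ex_finite_lim_seq_incr (sum_n (fun i => Rabs (mu (C i)))) (ba_norm Alg mu))
    as [l Hl].
  - intros n. rewrite sum_Sn. pose proof (Rabs_pos (mu (C (S n)))). unfold plus; simpl. lra.
  - intros n. apply disjoint_partial_sum, ba.
  - exists l. exact Hl.
Qed.

Lemma disjoint_Series_le mu : is_ba Alg mu -> Series (fun i => Rabs (mu (C i))) <= ba_norm Alg mu.
Proof.
  intros ba. pose proof (Series_correct _ (disjoint_ex_series mu ba)) as H.
  apply (is_lim_seq_le (sum_n (fun i => Rabs (mu (C i)))) (fun _ => ba_norm Alg mu)
    (Finite (Series (fun i => Rabs (mu (C i))))) (Finite (ba_norm Alg mu))).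
  - intros n. apply disjoint_partial_sum, ba.
  - exact H.
  - apply is_lim_seq_const.
Qed.

Lemma disjoint_lim mu eps : is_ba Alg mu -> 0 < eps ->
  exists N, forall n, (N <= n)%nat -> Rabs (mu (C n)) < eps.
Proof.
  intros ba He. pose proof (ex_series_lim_0 _ (disjoint_ex_series mu ba)) as H.
  apply is_lim_seq_Reals in H. destruct (H eps He) as [N HN]. exists N. intros n Hn.
  specialize (HN n Hn). unfold Rdist in HN. rewrite Rminus_0_r, Rabs_Rabsolu in HN. exact HN.
Qed.

Lemma disjoint_tail mu eps : is_ba Alg mu -> 0 < eps ->
  exists J, Series (fun i => Rabs (mu (C (J + i)%nat))) < eps.
Proof.
  intros ba He. pose proof (disjoint_ex_series mu ba) as ex.
  set (a := fun i => Rabs (mu (C i))) in *.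
  pose proof (Series_correct a ex) as H. apply is_series_Reals in H.
  destruct (H eps He) as [N HN]. exists (S N).
  specialize (HN N (Nat.le_refl N)). unfold Rdist in HN.
  pose proof (Series_incr_n a (S N) ltac:(lia) ex) as E. simpl Init.Nat.pred in E.
  rewrite E in HN. apply Rabs_lt_between in HN. unfold a in *. lra.
Qed.

Context (b : nat -> R).
Context (Hb : forall i, Rabs (b i) <= 1).

Lemma weighted_ex_series mu : is_ba Alg mu -> ex_series (fun i => Rabs (b i * mu (C i))).
Proof.
  intros ba. apply ex_series_dominated with (fun i => Rabs (mu (C i))).
  - intros; apply Rabs_pos.
  - intros i. rewrite Rabs_mult. pose proof (Rabs_pos (mu (C i))). pose proof (Hb i). nra.
  - apply disjoint_ex_series, ba.
Qed.

Lemma weighted_Series_le mu : is_ba Alg mu ->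
  Rabs (Series (fun i => b i * mu (C i))) <= Series (fun i => Rabs (mu (C i))).
Proof.
  intros ba. eapply Rle_trans; [apply Series_Rabs, weighted_ex_series, ba|].
  apply Series_le; [|apply disjoint_ex_series, ba].
  intros i. split; [apply Rabs_pos|].
  rewrite Rabs_mult. pose proof (Rabs_pos (mu (C i))). pose proof (Hb i). nra.
Qed.

(** The map from mu to the sequence mu (C i) is a contraction of ba into l^1, with which the bounded
    sequence b can be paired. *)
Lemma weighted_functional : cont_lin_functional Alg (fun mu => Series (fun i => b i * mu (C i))).
Proof.
  split.
  - intros u v mu nu bmu bnu. rewrite <- !Series_scal_l, <- Series_plus.
    + apply Series_ext. intros i. ring.
    + apply (ex_series_scal_l u (fun i => b i * mu (C i))), ex_series_Rabs, weighted_ex_series, bmu.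
    + apply (ex_series_scal_l v (fun i => b i * nu (C i))), ex_series_Rabs, weighted_ex_series, bnu.
  - exists 1. intros mu ba. rewrite Rmult_1_l.
    eapply Rle_trans; [apply weighted_Series_le, ba | apply disjoint_Series_le, ba].
Qed.

End DisjointSeries.

Section WeaklyCompact.
Context {Om : Type} {Alg : (Om -> Prop) -> Prop} (hAlg : is_algebra Alg).
Context (M : setfun Om -> Prop).
Context (Mba : forall mu, M mu -> is_ba Alg mu).

Lemma weak_nbhd_open fs eps x : Forall (cont_lin_functional Alg) fs ->
  weakly_open Alg (weak_nbhd Alg fs eps x).
Proof.
  intros Hfs. split; [intros y [ba _]; exact ba|]. intros y [_ Hy].
  assert (E : exists d, 0 < d /\ Forall (fun f => Rabs (f y - f x) + d <= eps) fs).
  { clear Hfs. induction Hy as [|f fs Hf _ [d [Hd IH]]].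
    - exists 1. split; [lra | constructor].
    - exists (Rmin d (eps - Rabs (f y - f x))). split; [apply Rmin_glb_lt; lra|].
      pose proof (Rmin_l d (eps - Rabs (f y - f x))). pose proof (Rmin_r d (eps - Rabs (f y - f x))).
      constructor; [lra|]. eapply Forall_impl; [|exact IH]. simpl. intros g Hg. lra. }
  destruct E as [d [Hd E]]. exists fs, d. split; [exact Hd|]. split; [exact Hfs|].
  intros z [zba Hz]. split; [exact zba|]. rewrite Forall_forall in *. intros f Hf.
  specialize (Hz f Hf). specialize (E f Hf).
  apply Rabs_lt_between in Hz.
  assert (E' : Rabs (f y - f x) <= eps - d) by lra.
  apply Rabs_le_between in E'. apply Rabs_lt_between. lra.
Qed.

Definition cluster_point (x : nat -> setfun Om) (y : setfun Om) : Prop :=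
  is_ba Alg y /\ forall fs eps N, 0 < eps -> Forall (cont_lin_functional Alg) fs ->
    exists n, (N <= n)%nat /\ weak_nbhd Alg fs eps y (x n).

(** Otherwise every point of ba has an open neighbourhood missing a tail of x; a finite subcover
    would miss a common tail, whose first term lies in the closure. *)
Lemma weakly_compact_cluster x : cond_ii Alg M -> (forall n, M (x n)) ->
  exists y, cluster_point x y.
Proof.
  intros cpt Hx. apply NNPP. intros H.
  destruct (cpt (fun U => weakly_open Alg U /\ exists N, forall n, (N <= n)%nat -> ~ U (x n)))
    as [l [Hl Hcov]].
  - intros U [HU _]. exact HU.
  - intros y [yba _]. apply NNPP. intros nU. apply H. exists y. split; [exact yba|].
    intros fs eps N He Hfs. apply NNPP. intros nn. apply nU.
    exists (weak_nbhd Alg fs eps y). split; [split; [apply weak_nbhd_open, Hfs|]|].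
    + exists N. intros n Hn Hu. apply nn. exists n. auto.
    + split; [exact yba|]. apply Forall_forall. intros f _.
      rewrite Rminus_diag, Rabs_R0. exact He.
  - assert (E : exists N, Forall (fun U : setfun Om -> Prop =>
                  forall n, (N <= n)%nat -> ~ U (x n)) l).
    { clear Hcov. induction Hl as [|U l [_ [N HN]] _ [N' IH]]; [exists 0%nat; constructor|].
      exists (Nat.max N N'). constructor.
      - intros n Hn. apply HN. lia.
      - eapply Forall_impl; [|exact IH]. simpl. intros V HV n Hn. apply HV. lia. }
    destruct E as [N HN].
    assert (cl : weak_closure Alg M (x N)).
    { split; [auto|]. intros fs eps He _. exists (x N). split; [auto|]. split; [auto|].
      apply Forall_forall. intros f _. rewrite Rminus_diag, Rabs_R0. exact He. }
    specialize (Hcov (x N) cl). rewrite Forall_forall in HN. apply Exists_exists in Hcov.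
    destruct Hcov as [U [HU Ux]]. exact (HN U HU N (Nat.le_refl N) Ux).
Qed.

(* Gliding hump: subtracting a cluster point makes finitely many coordinates small infinitely often, which extracts a subsequence whose matrix is nearly diagonal; pairing it with the signs of the diagonal contradicts clustering. *)
Lemma weakly_compact_s_bounded : cond_ii Alg M -> s_bounded (Alg := Alg) M.
Proof.
  intros cpt A mu eps He HA dA Hmu. apply NNPP. intros H.
  destruct (shrink_disjoint hAlg M Mba A mu eps HA dA Hmu He) as [B [HB [dB low]]].
  { intros n. apply Rnot_lt_le. intros l. apply H. exists n. exact l. }
  clear H. set (e := eps / 3) in *. assert (Hpe : 0 < e) by (unfold e; lra).
  destruct (weakly_compact_cluster mu cpt Hmu) as [mus [sba clus]].
  set (y := fun n A => 1 * mu n A + (-1) * mus A).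
  assert (yba : forall n, is_ba Alg (y n)) by (intros n; apply ba_lin; auto).
  (* [mus] tends to 0 along disjoint sets, so from [N0] on subtracting it costs the diagonal at most
     e/4 and leaves 3e/4. *)
  destruct (disjoint_lim hAlg B HB dB mus (e / 4) sba ltac:(lra)) as [N0 HN0].
  assert (Hq : forall k, 0 < e / 16 * (1 / 2) ^ k).
  { intros k. apply Rmult_lt_0_compat; [lra | apply pow_lt; lra]. }
  (* Both off-diagonal bounds decay in the column index: earlier rows at the new column by
     summability, the new row at earlier columns by clustering at [mus]. *)
  destruct (sequence_choice 0%nat (fun _ n => (N0 <= n)%nat)
    (fun i p k n => (p < n)%nat /\ Rabs (y p (B n)) <= e / 16 * (1 / 2) ^ k /\
       Rabs (y n (B p)) <= e / 16 * (1 / 2) ^ i)) as [f [Hf1 Hf2]].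
  { intros k h _.
    destruct (function_choice (fun i N => forall n, (N <= n)%nat ->
      Rabs (y (h i) (B n)) < e / 16 * (1 / 2) ^ k)) as [g Hg].
    { intros i. apply (disjoint_lim hAlg); auto. }
    destruct (initial_segment_bounded h k) as [N1 HN1]. destruct (initial_segment_bounded g k) as [N2 HN2].
    destruct (clus (map (fun i => fun nu : setfun Om => nu (B (h i))) (seq 0 k))
      (e / 16 * (1 / 2) ^ k) (Nat.max N0 (Nat.max (S N1) N2)) (Hq k)) as [n [Hn [_ Fn]]].
    { apply Forall_forall. intros phi Hphi. apply in_map_iff in Hphi.
      destruct Hphi as [i [<- _]]. apply (evaluation_functional hAlg). }
    exists n. split; [lia|]. intros i Hi.
    specialize (HN1 i Hi). specialize (HN2 i Hi). split; [lia|]. split.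
    - apply Rlt_le, Hg. lia.
    - rewrite Forall_forall in Fn.
      specialize (Fn (fun nu => nu (B (h i)))). unfold y.
      replace (1 * mu n (B (h i)) + -1 * mus (B (h i))) with (mu n (B (h i)) - mus (B (h i))) by ring.
      eapply Rle_trans; [apply Rlt_le, Fn|].
      + apply in_map_iff. exists i. split; [reflexivity | apply in_seq; lia].
      + apply Rmult_le_compat_l; [lra|].
        replace k with (i + (k - i))%nat by lia. rewrite pow_add.
        assert (0 < (1 / 2) ^ i) by (apply pow_lt; lra).
        assert ((1 / 2) ^ (k - i) <= 1 ^ (k - i)) by (apply pow_incr; lra).
        rewrite pow1 in *. nra. }
  set (C := fun i => B (f i)).
  assert (HC : forall i, Alg (C i)) by (intros; apply HB).
  assert (dC : pairwise_disj C).
  { apply pairwise_disj_lt. intros i j Hij. apply dB.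
    pose proof (proj1 (Hf2 i j Hij)). lia. }
  assert (off : forall k i, i <> k -> Rabs (y (f k) (C i)) <= e / 16 * (1 / 2) ^ i).
  { intros k i ne. destruct (Nat.lt_total i k) as [l|[E|l]]; [|contradiction|].
    - apply (Hf2 i k l).
    - apply (Hf2 k i l). }
  assert (diag : forall k, 3 * e / 4 <= Rabs (y (f k) (C k))).
  { intros k. pose proof (low (f k)) as l. pose proof (HN0 (f k) (Hf1 k)) as s.
    unfold y, C. pose proof (Rabs_triang_inv (mu (f k) (B (f k))) (mus (B (f k)))) as T.
    replace (1 * mu (f k) (B (f k)) + -1 * mus (B (f k))) with
      (mu (f k) (B (f k)) - mus (B (f k))) by ring. lra. }
  set (b := fun i => if Rle_dec 0 (y (f i) (C i)) then 1 else -1).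
  assert (Hb : forall i, Rabs (b i) <= 1).
  { intros i. unfold b. destruct (Rle_dec _ _); apply Rabs_le_between; lra. }
  assert (Hbd : forall i, b i * y (f i) (C i) = Rabs (y (f i) (C i))).
  { intros i. unfold b. destruct (Rle_dec _ _).
    - rewrite Rabs_pos_eq by assumption. ring.
    - rewrite Rabs_left by lra. ring. }
  (* The subsequence clusters at some [nus], with no comparison to [mus] at hand; their difference z
     is made harmless by keeping only the columns from J on. *)
  destruct (weakly_compact_cluster (fun k => mu (f k)) cpt) as [nus [nba clus']]; [auto|].
  set (z := fun A => 1 * nus A + (-1) * mus A).
  assert (zba : is_ba Alg z) by (apply ba_lin; assumption).
  destruct (disjoint_tail hAlg C HC dC z (e / 4) zba ltac:(lra)) as [J HJ].
  set (CJ := fun i => C (J + i)%nat). set (bJ := fun i => b (J + i)%nat).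
  assert (HCJ : forall i, Alg (CJ i)) by (intros; apply HC).
  assert (dCJ : pairwise_disj CJ) by (intros i j ne; apply dC; lia).
  assert (HbJ : forall i, Rabs (bJ i) <= 1) by (intros; apply Hb).
  set (phi := fun nu : setfun Om => Series (fun i => bJ i * nu (CJ i))).
  assert (Hphi : cont_lin_functional Alg phi) by (apply (weighted_functional hAlg); assumption).
  destruct (clus' (phi :: nil) (e / 4) J ltac:(lra)) as [k [Hk [_ Fk]]]; [auto|].
  inversion Fk as [|? ? Ek _]; subst. clear Fk.
  assert (E1 : phi (y (f k)) - phi z = phi (mu (f k)) - phi nus).
  { unfold y, z. rewrite !(proj1 Hphi) by auto. ring. }
  assert (E2 : Rabs (phi z) < e / 4).
  { eapply Rle_lt_trans; [apply (weighted_Series_le hAlg CJ HCJ dCJ bJ HbJ z zba) | exact HJ]. }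
  (* Adding c makes the off-diagonal terms nonnegative, so the diagonal term bounds the series from
     below. As c sums to e/8, phi (y (f k)) is at least 5e/8, against the e/2 allowed by clustering
     and phi z. *)
  set (a := fun i => bJ i * y (f k) (CJ i)). set (c := fun i => e / 8 * (1 / 2) ^ S i).
  assert (sc : is_series c (e / 8)).
  { replace (e / 8) with (e / 8 * 1) by ring.
    exact (is_series_scal_l (e / 8) _ _ is_series_half). }
  assert (exa : ex_series a) by (apply ex_series_Rabs, (weighted_ex_series hAlg); auto).
  assert (offJ : forall i, i <> (k - J)%nat -> 0 <= a i + c i).
  { intros i ne. pose proof (off k (J + i)%nat ltac:(lia)) as O.
    assert (Rabs (a i) <= c i).
    { unfold a. rewrite Rabs_mult. fold (CJ i) in O.
      apply Rle_trans with (1 * Rabs (y (f k) (CJ i))).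
      - apply Rmult_le_compat_r; [apply Rabs_pos | apply HbJ].
      - rewrite Rmult_1_l. eapply Rle_trans; [exact O|]. unfold c.
        rewrite pow_add. simpl.
        assert (0 < (1 / 2) ^ i) by (apply pow_lt; lra).
        assert (P : (1 / 2) ^ J <= 1 ^ J) by (apply pow_incr; lra). rewrite pow1 in P.
        assert ((1 / 2) ^ J * (1 / 2) ^ i <= (1 / 2) ^ i) by nra. nra. }
    apply Rabs_le_between in H. lra. }
  assert (onJ : 3 * e / 4 <= a (k - J)%nat).
  { unfold a, bJ, CJ. replace (J + (k - J))%nat with k by lia. rewrite Hbd. apply diag. }
  assert (cpos : forall i, 0 < c i).
  { intros i. apply Rmult_lt_0_compat; [lra | apply pow_lt; lra]. }
  assert (E3 : 3 * e / 4 <= Series (fun i => a i + c i)).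
  { apply Rle_trans with (a (k - J)%nat + c (k - J)%nat); [pose proof (cpos (k - J)%nat); lra|].
    apply (Series_ge_term (fun i => a i + c i)).
    - intros i. destruct (Nat.eq_dec i (k - J)) as [->|ne]; [|auto].
      pose proof (cpos (k - J)%nat). lra.
    - apply (@ex_series_plus R_AbsRing R_NormedModule a c); [exact exa | exists (e / 8); exact sc]. }
  rewrite Series_plus in E3 by (solve [exact exa | exists (e / 8); exact sc]).
  rewrite (is_series_unique c _ sc) in E3. change (Series a) with (phi (y (f k))) in E3.
  rewrite <- E1 in Ek. apply Rabs_lt_between in Ek, E2. lra.
Qed.

End WeaklyCompact.

(** * Countably additive families *)

Section CountablyAdditive.
Context {Om : Type} {Alg : (Om -> Prop) -> Prop} (hS : is_sigma_algebra Alg).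
Context (A : nat -> Om -> Prop).
Context (HA : forall n, Alg (A n)).
Context (dA : pairwise_disj A).

Let hAlg : is_algebra Alg := proj1 hS.

Definition tail_union (n : nat) : Om -> Prop := setD (fun x => exists i, A i x) (punion A n).

Lemma alg_tail_union n : Alg (tail_union n).
Proof.
  apply (alg_setD hAlg); [apply (proj2 hS), HA | apply (alg_punion hAlg), HA].
Qed.

Lemma ca_tail mu P eps : is_ca Alg mu -> Alg P -> 0 < eps ->
  exists N, forall n, (N <= n)%nat -> Rabs (mu (setI P (tail_union n))) < eps.
Proof.
  intros [ba ca] HP He. set (D := fun x => exists i, A i x).
  assert (HD : Alg D) by (apply (proj2 hS), HA).
  pose proof (ca (fun n => setI P (A n))) as H.
  assert (ED : (fun x => exists n, setI P (A n) x) = setI P D).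
  { apply functional_extensionality; intro x; apply propositional_extensionality.
      unfold setI, D. firstorder. }
  cbv beta in H. rewrite ED in H.
  destruct (H (fun n => alg_setI hAlg _ _ HP (HA n))) with (eps := eps) as [N HN].
  - intros i j ne x [_ Ai] [_ Aj]. exact (dA i j ne x Ai Aj).
  - apply (alg_setI hAlg); assumption.
  - exact He.
  - assert (S1 : forall n, sum_f_R0 (fun n => mu (setI P (A n))) n = mu (setI P (punion A (S n)))).
    { induction n as [|n IH].
      - simpl. rewrite punion_S, punion_0. f_equal. sets.
      - simpl. rewrite IH, (punion_S A (S n)).
        replace (setI P (setU (punion A (S n)) (A (S n)))) with
          (setU (setI P (punion A (S n))) (setI P (A (S n)))) by sets.
        symmetry. apply (proj1 (proj2 ba)).
        + apply (alg_setI hAlg); [exact HP | apply (alg_punion hAlg), HA].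
        + apply (alg_setI hAlg); auto.
        + pose proof (disj_punion A dA (S n)). sets. }
    exists (S N). intros n Hn. destruct n as [|n]; [lia|].
    specialize (HN n ltac:(lia)). unfold Rdist in HN. rewrite S1 in HN.
    rewrite (ba_split hAlg mu (setI P D) (punion A (S n)) ba) in HN.
    + replace (setI (setI P D) (punion A (S n))) with (setI P (punion A (S n))) in HN.
      2:{ assert (subset (punion A (S n)) D) by (intros x [i [_ Ai]]; exists i; exact Ai). sets. }
      replace (setD (setI P D) (punion A (S n))) with (setI P (tail_union (S n))) in HN
        by (unfold tail_union; fold D; sets).
      apply Rabs_lt_between in HN. apply Rabs_lt_between. lra.
    + apply (alg_setI hAlg); assumption.
    + apply (alg_punion hAlg), HA.
Qed.

(** Works with values of mu only: for a near-optimal H in the whole union D, the variation of the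
    tail is controlled by mu on the parts of H and of D \ H inside the tail, to which [ca_tail]
    applies. *)
Lemma tv_tail_small mu eps : is_ca Alg mu -> 0 < eps ->
  exists N, tv Alg mu (tail_union N) < eps.
Proof.
  intros ca He. pose proof (proj1 ca) as ba.
  set (D := tail_union 0). assert (HD : Alg D) by apply alg_tail_union.
  destruct (tv_hahn hAlg mu D (eps / 3) ba HD) as [H [HH [sub E]]]; [lra|].
  destruct (ca_tail mu H (eps / 3) ca HH) as [N1 HN1]; [lra|].
  destruct (ca_tail mu (setD D H) (eps / 3) ca) as [N2 HN2]; [algs|lra|].
  set (n := Nat.max N1 N2). exists n.
  specialize (HN1 n ltac:(lia)). specialize (HN2 n ltac:(lia)).
  set (T := tail_union n) in *. assert (HT : Alg T) by apply alg_tail_union.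
  assert (TD : subset T D).
  { intros x [Ax _]. split; [exact Ax|]. rewrite punion_0. intros []. }
  pose proof (tv_ge hAlg mu (setD D T) H ba ltac:(algs) HH) as G.
  rewrite (ba_sub hAlg (tv Alg mu) D T) in E by
    (solve [assumption | apply (tv_is_ba hAlg); assumption]).
  rewrite (ba_split hAlg mu H T ba HH HT) in E.
  rewrite (ba_split hAlg mu (setD D H) T ba ltac:(algs) HT) in E.
  replace (setI (setD D T) H) with (setD H T) in G by sets.
  replace (setD (setD D T) H) with (setD (setD D H) T) in G by sets.
  apply Rabs_lt_between in HN1, HN2. lra.
Qed.

End CountablyAdditive.

(** Here lam(B) is the limit along [G] of |mu n|(B meet A n). It is carried by every tail of the
    disjoint sequence, while each [mu k] is small on late tails: hence orthogonality. If lam(B^c) is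
    small, some [mu n] has most of its mass on [A n] inside B, which rules out uniformity. *)
Lemma vi_s_bounded {Om : Type} {Alg : (Om -> Prop) -> Prop} (M : setfun Om -> Prop) (K : R) :
  is_sigma_algebra Alg -> (forall mu, M mu -> is_ca Alg mu) ->
  (forall mu, M mu -> ba_norm Alg mu <= K) ->
  cond_vi Alg M -> s_bounded (Alg := Alg) M.
Proof.
  intros hS Mca MK vi A mu eps He HA dA Hmu. apply NNPP. intros H.
  assert (low : forall n, eps <= tv Alg (mu n) (A n)).
  { intros n. apply Rnot_lt_le. intros l. apply H. exists n. exact l. }
  clear H. pose proof (proj1 hS) as hAlg.
  assert (Mba : forall mu, M mu -> is_ba Alg mu) by (intros nu Hnu; apply (Mca nu Hnu)).
  destruct (ultrafilter_extension nat (fun P => exists N, P = (fun n => (N <= n)%nat)))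
    as [G [UG HG]].
  { intros l Hl. assert (E : exists N, Forall (fun P : nat -> Prop => forall n, (N <= n)%nat -> P n) l).
    { induction Hl as [|P l [N ->] _ [N' IH]]; [exists 0%nat; constructor|].
      exists (Nat.max N N'). constructor; [intros; lia|].
      eapply Forall_impl; [|exact IH]. simpl. intros P HP n Hn. apply HP. lia. }
    destruct E as [N HN]. exists N. eapply Forall_impl; [|exact HN]. simpl. auto. }
  assert (Gge : forall N, G (fun n => (N <= n)%nat)) by (intros N; apply HG; exists N; reflexivity).
  assert (nn : forall n B, 0 <= tv Alg (mu n) B) by (intros; apply (tv_nonneg hAlg); auto).
  assert (le : forall n B, tv Alg (mu n) B <= K).
  { intros n B. eapply Rle_trans; [apply (tv_le_norm hAlg); auto | auto]. }
  destruct (function_choice (fun B l => forall e, 0 < e ->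
    G (fun n => Rabs (tv Alg (mu n) (setI B (A n)) - l) < e))) as [lim Hlim].
  { intros B. apply (ultralim_exists _ G (fun n => tv Alg (mu n) (setI B (A n))) K UG).
    apply (ultra_up _ UG _ _) with (2 := Gge 0%nat). intros n _.
    rewrite Rabs_pos_eq; auto. }
  assert (limpos : forall B, 0 <= lim B).
  { intros B. apply le_epsilon. intros e Hpe.
    destruct (ultra_ex _ UG _ (Hlim B e Hpe)) as [n E].
    apply Rabs_lt_between in E. pose proof (nn n (setI B (A n))). lra. }
  set (lam := restr Alg lim).
  assert (lba : is_ba Alg lam).
  { apply restr_ba with (K + 1); [exact hAlg| |].
    - intros B C HB HC BC. apply cond_eq. intros e Hpe.
      destruct (ultra_ex _ UG _ (ultra_and _ UG _ _ (Hlim (setU B C) (e / 3) ltac:(lra))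
        (ultra_and _ UG _ _ (Hlim B (e / 3) ltac:(lra)) (Hlim C (e / 3) ltac:(lra)))))
        as [n [E1 [E2 E3]]].
      pose proof (HA n). replace (setI (setU B C) (A n)) with (setU (setI B (A n)) (setI C (A n))) in E1 by sets.
      rewrite (tv_setU hAlg) in E1 by (solve [auto | algs | sets]).
      apply Rabs_lt_between in E1, E2, E3. apply Rabs_lt_between. lra.
    - intros B HB. destruct (ultra_ex _ UG _ (Hlim B 1 ltac:(lra))) as [n E].
      pose proof (nn n (setI B (A n))). pose proof (le n (setI B (A n))).
      rewrite Rabs_pos_eq by apply limpos. apply Rabs_lt_between in E. lra. }
  assert (lpos : forall B, 0 <= lam B).
  { intros B. unfold lam, restr. destruct (excluded_middle_informative _); [apply limpos | lra]. }
  destruct (vi (fun nu => exists n, nu = mu n) lam) with (eps := eps / 2) as [B [HB EB]]; auto.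
  - intros nu [n ->]. auto.
  - intros nu [k ->] e Hpe.
    destruct (tv_tail_small hS A HA dA (mu k) e) as [N HN]; auto.
    set (T := tail_union A N) in *. assert (HT : Alg T) by (apply (alg_tail_union hS); auto).
    exists (setC T). split; [algs|]. replace (setC (setC T)) with T by sets.
    rewrite (tv_pos hAlg lam _ lba lpos).
    (* For n >= N the set [A n] lies in [T], and these n form a set of [G] because [G] is free. *)
    assert (E : lam (setC T) = 0); [|lra].
    unfold lam. rewrite restr_on by algs. apply cond_eq. intros e' Hpe'.
    destruct (ultra_ex _ UG _ (ultra_and _ UG _ _ (Hlim (setC T) e' Hpe') (Gge N))) as [n [E Hn]].
    replace (setI (setC T) (A n)) with (@set0 Om) in E.
    + rewrite (ba_set0 hAlg (tv Alg (mu n))) in E by (apply (tv_is_ba hAlg); auto).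
      rewrite Rabs_minus_sym. exact E.
    + assert (sub : subset (A n) T).
      { intros x Ax. split; [exists n; exact Ax|]. intros [i [Hi Ai]].
        exact (dA i n ltac:(lia) x Ai Ax). }
      sets.
  - lra.
  - rewrite (tv_pos hAlg lam _ lba lpos) in EB. unfold lam in EB. rewrite restr_on in EB by algs.
    (* One n already contradicts: eps <= |mu n|(B) + |mu n|(A n \ B) < sup + lam(B^c) + eps/2 <
       eps. *)
    destruct (ultra_ex _ UG _ (Hlim (setC B) (eps / 2) ltac:(lra))) as [n E].
    pose proof (sup_tv_ub hAlg M Mba K MK (fun nu => exists n, nu = mu n) (mu n) B) as E1.
    pose proof (low n) as E2. pose proof (HA n) as HAn.
    rewrite (ba_split hAlg (tv Alg (mu n)) (A n) B) in E2 by
      (solve [auto | apply (tv_is_ba hAlg); auto]).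
    pose proof (tv_mono hAlg (mu n) (setI (A n) B) B (Mba _ (Hmu n)) ltac:(algs) HB ltac:(sets)) as E3.
    replace (setI (setC B) (A n)) with (setD (A n) B) in E by sets.
    apply Rabs_lt_between in E.
    assert (E1' : tv Alg (mu n) B <= sup_tv Alg (fun nu => exists n, nu = mu n) B).
    { apply E1; [intros nu [j ->]; auto | exists n; reflexivity]. }
    lra.
Qed.

Theorem mainTheorem5 (Om : Type) (Alg : (Om -> Prop) -> Prop)
    (M : setfun Om -> Prop)
    (hAlg : is_algebra Alg)
    (hMba : forall mu, M mu -> is_ba Alg mu)
    (hMbdd : exists K, forall mu, M mu -> ba_norm Alg mu <= K)
    (hMne : exists mu, M mu) :
  (cond_i Alg M <-> cond_ii Alg M) /\
  (cond_ii Alg M <-> cond_iii Alg M) /\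
  (cond_iii Alg M <-> cond_iv Alg M) /\
  (cond_iv Alg M <-> cond_v Alg M) /\
  (cond_v Alg M -> cond_vi Alg M) /\
  (is_sigma_algebra Alg -> (forall mu, M mu -> is_ca Alg mu) ->
     cond_vi Alg M -> cond_iii Alg M).
Proof.
  destruct hMbdd as [K MK].
  assert (from_i : cond_i Alg M -> s_bounded (Alg := Alg) M).
  { intros H. destruct (i_control hAlg M hMba H) as [m Hm].
    exact (control_s_bounded hAlg M hMba K MK m Hm). }
  (* [hMne] enters here: an element of A(M) is a series over an infinite sequence of members, so at
     least one member must exist. *)
  assert (to_i : s_bounded (Alg := Alg) M -> cond_i Alg M).
  { intros H. apply (finitely_controlled_i hAlg M hMba hMne).
    apply (s_bounded_finitely_controlled hAlg M hMba H). }
  assert (from_ii : cond_ii Alg M -> s_bounded (Alg := Alg) M).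
  { apply (weakly_compact_s_bounded hAlg M hMba). }
  assert (to_ii : s_bounded (Alg := Alg) M -> cond_ii Alg M).
  { intros H. destruct (i_control hAlg M hMba (to_i H)) as [m Hm].
    exact (control_weakly_compact hAlg M hMba K MK m Hm). }
  pose proof (s_bounded_iii hAlg M hMba) as to_iii.
  pose proof (iii_s_bounded hAlg M hMba) as from_iii.
  pose proof (s_bounded_iv hAlg M hMba) as to_iv.
  pose proof (iv_s_bounded hAlg M hMba) as from_iv.
  pose proof (s_bounded_v hAlg M hMba) as to_v.
  pose proof (v_s_bounded hAlg M hMba K MK) as from_v.
  pose proof (s_bounded_vi hAlg M hMba) as to_vi.
  split; [split; auto|]. split; [split; auto|]. split; [split; auto|]. split; [split; auto|].
  split; [auto|]. intros hS Mca vi. apply to_iii. exact (vi_s_bounded M K hS Mca MK vi).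
Qed.
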